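(* Let $E=\{x_1,\dots,x_n\}\subset\mathbb{R}^2$ with $x_i\,\mathcal{I}\,x_j$ for all $i\neq j$. The Max-Min $p$-dispersion problem is polynomially solvable to optimality in $E$. For $p=2$ and $p=3$ it is solvable in $O(n)$ time using $O(1)$ additional memory space. For $p>3$ there is an algorithm (a dynamic programming algorithm) that solves it, returning the optimal value and an optimal selection of $p$ points, in $O(pn\log n)$ time and $O(n)$ memory space.
   Context: For $y=(y^1,y^2),z=(z^1,z^2)\in\mathbb{R}^2$ write $y\prec z$ iff $y^1<z^1$ and $y^2>z^2$, and $y\,\mathcal{I}\,z$ iff $y\prec z$ or $z\prec y$ (so $E$ is a two-dimensional Pareto front). Fix $\alpha>0$ and let $d$ be the Euclidean distance on $\mathbb{R}^2$. For an integer $2\le p\le n$, let $D_p$ be the set of $p$-tuples $(z_1,\dots,z_p)\in E^p$ of pairwise distinct points. The Max-Min $p$-dispersion problem is $\max_{(z_1,\dots,z_p)\in D_p}\min_{1\le i<j\le p}d(z_i,z_j)^\alpha$. Complexities are in a model where arithmetic operations, comparisons and evaluation of $d(\cdot,\cdot)^\alpha$ take $O(1)$ time; ''additional memory space'' excludes the storage of the input. *)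

(* Defs.v *)
From Stdlib Require Import Reals Lra Lia List Arith.
Open Scope R_scope.

Definition point := (R * R)%type.

Definition prec (y z : point) : Prop := fst y < fst z /\ snd y > snd z.
Definition incomp (y z : point) : Prop := prec y z \/ prec z y.

Definition dist (y z : point) : R :=
  sqrt ((fst y - fst z) ^ 2 + (snd y - snd z) ^ 2).

Definition dpow (alpha : R) (y z : point) : R :=
  if Req_EM_T (dist y z) 0 then 0 else Rpower (dist y z) alpha.

Definition pareto (n : nat) (x : nat -> point) : Prop :=
  forall i j, (i < n)%nat -> (j < n)%nat -> i <> j -> incomp (x i) (x j).

Definition feasible (n p : nat) (sel : nat -> nat) : Prop :=
  (forall i, (i < p)%nat -> (sel i < n)%nat) /\
  (forall i j, (i < p)%nat -> (j < p)%nat -> sel i = sel j -> i = j).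

Definition min_pairwise (alpha : R) (x : nat -> point) (p : nat)
  (sel : nat -> nat) (v : R) : Prop :=
  (forall i j, (i < j)%nat -> (j < p)%nat -> v <= dpow alpha (x (sel i)) (x (sel j))) /\
  (exists i j, (i < j)%nat /\ (j < p)%nat /\ v = dpow alpha (x (sel i)) (x (sel j))).

Definition optimal (alpha : R) (n p : nat) (x : nat -> point)
  (sel : nat -> nat) (v : R) : Prop :=
  feasible n p sel /\ min_pairwise alpha x p sel v /\
  (forall sel' v', feasible n p sel' -> min_pairwise alpha x p sel' v' -> v' <= v).

(* Memory: nat cells mn : nat -> nat and real cells mr : nat -> R, with direct
   and indirect addressing.  The input (n, p and the points) is read-only and is
   accessed only through the Read* instructions (so it is not counted as
   memory).  Every instruction costs one time unit: arithmetic on reals and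
   words, comparisons and evaluations of d(.,.)^alpha are O(1).  Words are
   bounded by a word bound W (a polynomial in n, chosen by the algorithm), so
   that data cannot be packed into unbounded integers.  Space = 1 + the largest
   address ever accessed (in either memory). *)

Inductive nop := NAdd | NSub | NMul | NDiv.
Inductive rop := RAdd | RSub | RMul | RDiv.

Inductive instr :=
| NConst (a k : nat)
| NArith (o : nop) (a b c : nat)
| NLoad (a b : nat)
| NStore (a b : nat)
| RZero (a : nat)
| ROne (a : nat)
| RArith (o : rop) (a b c : nat)
| RLoad (a b : nat)
| RStore (a b : nat)
| ReadN (a : nat)
| ReadP (a : nat)
| ReadX (a b : nat)
| ReadY (a b : nat)
| ReadD (a b c : nat)
| JmpNLt (b c t : nat)
| JmpRLt (b c t : nat)
| Jmp (t : nat)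
| Halt.

Record state := mkState {
  pc : nat;
  mn : nat -> nat;
  mr : nat -> R;
  used : nat;
  halted : bool }.

Definition init_state : state :=
  mkState 0 (fun _ => 0%nat) (fun _ => 0) 0 false.

Definition updN (f : nat -> nat) (a v : nat) : nat -> nat :=
  fun i => if Nat.eqb i a then v else f i.
Definition updR (f : nat -> R) (a : nat) (v : R) : nat -> R :=
  fun i => if Nat.eqb i a then v else f i.

Definition touch (u : nat) (l : list nat) : nat :=
  fold_left (fun m a => Nat.max m (S a)) l u.

Definition nopf (o : nop) : nat -> nat -> nat :=
  match o with NAdd => Nat.add | NSub => Nat.sub | NMul => Nat.mul | NDiv => Nat.div end.
Definition ropf (o : rop) : R -> R -> R :=
  match o with RAdd => Rplus | RSub => Rminus | RMul => Rmult | RDiv => Rdiv end.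

Definition writeN (W : nat) (s : state) (l : list nat) (a v : nat) : option state :=
  if Nat.ltb W v then None
  else Some (mkState (S (pc s)) (updN (mn s) a v) (mr s) (touch (used s) l) false).

Definition writeR (s : state) (l : list nat) (a : nat) (v : R) : option state :=
  Some (mkState (S (pc s)) (mn s) (updR (mr s) a v) (touch (used s) l) false).

Definition jump (s : state) (l : list nat) (b : bool) (t : nat) : option state :=
  Some (mkState (if b then t else S (pc s)) (mn s) (mr s) (touch (used s) l) false).

Definition step (prog : list instr) (W : nat) (alpha : R) (n p : nat)
  (x : nat -> point) (s : state) : option state :=
  if halted s then Some s else
  match nth_error prog (pc s) with
  | None => None
  | Some ins =>
    match ins with
    | NConst a k => writeN W s (a :: nil) a k
    | NArith o a b c => writeN W s (a :: b :: c :: nil) a (nopf o (mn s b) (mn s c))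
    | NLoad a b => writeN W s (a :: b :: mn s b :: nil) a (mn s (mn s b))
    | NStore a b => writeN W s (a :: b :: mn s a :: nil) (mn s a) (mn s b)
    | RZero a => writeR s (a :: nil) a 0
    | ROne a => writeR s (a :: nil) a 1
    | RArith o a b c => writeR s (a :: b :: c :: nil) a (ropf o (mr s b) (mr s c))
    | RLoad a b => writeR s (a :: b :: mn s b :: nil) a (mr s (mn s b))
    | RStore a b => writeR s (a :: b :: mn s a :: nil) (mn s a) (mr s b)
    | ReadN a => writeN W s (a :: nil) a n
    | ReadP a => writeN W s (a :: nil) a p
    | ReadX a b => if Nat.ltb (mn s b) n
                   then writeR s (a :: b :: nil) a (fst (x (mn s b))) else None
    | ReadY a b => if Nat.ltb (mn s b) n
                   then writeR s (a :: b :: nil) a (snd (x (mn s b))) else None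
    | ReadD a b c => if andb (Nat.ltb (mn s b) n) (Nat.ltb (mn s c) n)
                     then writeR s (a :: b :: c :: nil) a (dpow alpha (x (mn s b)) (x (mn s c)))
                     else None
    | JmpNLt b c t => jump s (b :: c :: nil) (Nat.ltb (mn s b) (mn s c)) t
    | JmpRLt b c t => jump s (b :: c :: nil)
                        (if Rlt_dec (mr s b) (mr s c) then true else false) t
    | Jmp t => jump s nil true t
    | Halt => Some (mkState (pc s) (mn s) (mr s) (used s) true)
    end
  end.

Fixpoint run (prog : list instr) (W : nat) (alpha : R) (n p : nat)
  (x : nat -> point) (k : nat) : option state :=
  match k with
  | O => Some init_state
  | S k' => match run prog W alpha n p x k' with
            | None => None
            | Some s => step prog W alpha n p x s
            end
  end.

Definition solves_within (prog : list instr) (W : nat) (alpha : R) (n p : nat)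
  (x : nat -> point) (time space : nat) : Prop :=
  exists t s, run prog W alpha n p x t = Some s /\ halted s = true /\
    (t <= time)%nat /\ (used s <= space)%nat /\
    optimal alpha n p x (mn s) (mr s 0%nat).

(* Main.v *)
Require Import Defs.
From Stdlib Require Import Reals Lra Lia List Arith.
Open Scope R_scope.

(** On a two-dimensional Pareto front sorted by first coordinate, the distance between
two points only grows when the interval between them grows.  Hence the minimum over all
pairs of a selection is attained by consecutive points, and the best value [C k i] of a
selection of [k] points ending at the [i]-th one satisfies
[C (k + 1) i = max_(j < i) (min (C k j) (d (j, i)))], where [C k j] increases with [j]
and [d (j, i)] decreases: only the crossing point matters, and it moves left with [i].
Knowing the optimal value, an optimal selection is found by taking greedily, from the
left, every point far enough from the last one taken.  Sorting by a tournament tree costs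
[O(n log n)].  For [p = 2] the two extreme points are optimal, and for [p = 3] one adds
the point whose nearer extreme point is farthest. *)

(** * Structured programs and their weakest preconditions *)

(** Linear space shapes the whole solution: a table of all [C k i], or of predecessors, would take
    about [p n] cells. Only one row is kept and overwritten from its right end; the crossing point
    never lies right of the entry being computed, so each new entry reads only old ones. What
    survives is the optimal value, which is why the selection has to be rebuilt by a greedy pass.
    The recurrence and that pass meet in the threshold form of [level]: for [v > 0], [v <= C] holds
    exactly when a chain with gaps at least [v] exists, so no maximum over selections has to be
    formed. The machine only has jumps, so programs are written with structured commands; their
    weakest preconditions count every step and bound addresses by [U] and words by [W], and resource
    bounds come out together with correctness. The selection must end up in the cells
    [0, .., p - 1], where the registers live, hence a separate output phase. *)

Inductive cmd :=
| Ins (i : instr)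
| Skip
| Seq (c1 c2 : cmd)
| IfN (b c : nat) (c1 c2 : cmd)
| IfR (b c : nat) (c1 c2 : cmd)
| While (b c : nat) (body : cmd).

Declare Scope cmd_scope.
Delimit Scope cmd_scope with cmd.
Bind Scope cmd_scope with cmd.
Notation "c1 ;; c2" := (Seq c1 c2) (at level 80, right associativity) : cmd_scope.
Coercion Ins : instr >-> cmd.

Fixpoint size (c : cmd) : nat :=
  match c with
  | Ins _ => 1
  | Skip => 0
  | Seq c1 c2 => size c1 + size c2
  | IfN _ _ c1 c2 | IfR _ _ c1 c2 => 2 + size c2 + size c1
  | While _ _ body => 3 + size body
  end.

Fixpoint compile (base : nat) (c : cmd) : list instr :=
  match c with
  | Ins i => i :: nil
  | Skip => nil
  | Seq c1 c2 => compile base c1 ++ compile (base + size c1) c2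
  | IfN b c c1 c2 =>
      JmpNLt b c (base + 2 + size c2) :: compile (base + 1) c2
        ++ Jmp (base + 2 + size c2 + size c1) :: compile (base + 2 + size c2) c1
  | IfR b c c1 c2 =>
      JmpRLt b c (base + 2 + size c2) :: compile (base + 1) c2
        ++ Jmp (base + 2 + size c2 + size c1) :: compile (base + 2 + size c2) c1
  | While b c body =>
      JmpNLt b c (base + 2) :: Jmp (base + 3 + size body)
        :: compile (base + 2) body ++ Jmp base :: nil
  end.

Lemma compile_length c base : length (compile base c) = size c.
Proof.
  revert base; induction c; intros base; cbn; rewrite ?length_app; cbn;
    rewrite ?IHc1, ?IHc2, ?IHc, ?length_app; cbn; rewrite ?IHc1, ?IHc2, ?IHc; lia.
Qed.

(* The first argument is the number of steps executed so far. *)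
Definition assertion := nat -> (nat -> nat) -> (nat -> R) -> Prop.

Section WeakestPrecondition.
Context (U W : nat) (alpha : R) (n p : nat) (x : nat -> point).

(** [NLoad] and [NStore] carry no bound by [W] on the value they move: soundness maintains [words],
    so every stored value is a word already. *)
Definition wp_instr (i : instr) (Q : assertion) : assertion := fun t N M =>
  match i with
  | NConst a k => (a < U)%nat /\ (k <= W)%nat /\ Q (S t) (updN N a k) M
  | NArith o a b c => (a < U /\ b < U /\ c < U)%nat /\ (nopf o (N b) (N c) <= W)%nat /\
      Q (S t) (updN N a (nopf o (N b) (N c))) M
  | NLoad a b => (a < U /\ b < U /\ N b < U)%nat /\
      Q (S t) (updN N a (N (N b))) M
  | NStore a b => (a < U /\ b < U /\ N a < U)%nat /\
      Q (S t) (updN N (N a) (N b)) M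
  | RZero a => (a < U)%nat /\ Q (S t) N (updR M a 0)
  | ROne a => (a < U)%nat /\ Q (S t) N (updR M a 1)
  | RArith o a b c => (a < U /\ b < U /\ c < U)%nat /\
      Q (S t) N (updR M a (ropf o (M b) (M c)))
  | RLoad a b => (a < U /\ b < U /\ N b < U)%nat /\ Q (S t) N (updR M a (M (N b)))
  | RStore a b => (a < U /\ b < U /\ N a < U)%nat /\ Q (S t) N (updR M (N a) (M b))
  | ReadN a => (a < U)%nat /\ (n <= W)%nat /\ Q (S t) (updN N a n) M
  | ReadP a => (a < U)%nat /\ (p <= W)%nat /\ Q (S t) (updN N a p) M
  | ReadX a b => (a < U /\ b < U)%nat /\ (N b < n)%nat /\ Q (S t) N (updR M a (fst (x (N b))))
  | ReadY a b => (a < U /\ b < U)%nat /\ (N b < n)%nat /\ Q (S t) N (updR M a (snd (x (N b))))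
  | ReadD a b c => (a < U /\ b < U /\ c < U)%nat /\ (N b < n /\ N c < n)%nat /\
      Q (S t) N (updR M a (dpow alpha (x (N b)) (x (N c))))
  | JmpNLt _ _ _ | JmpRLt _ _ _ | Jmp _ | Halt => False
  end.

(** The extra successors pay for the jumps of [compile]: an else branch, laid out first, ends with a
    jump over the then branch; a loop iteration pays its test and the jump back, and leaving a loop
    pays a failed test and a jump out. The fuel [k] makes this total correctness. *)
Fixpoint wp (c : cmd) (Q : assertion) : assertion :=
  match c with
  | Ins i => wp_instr i Q
  | Skip => Q
  | Seq c1 c2 => wp c1 (wp c2 Q)
  | IfN b c c1 c2 => fun t N M => (b < U /\ c < U)%nat /\
      ((N b < N c)%nat -> wp c1 Q (S t) N M) /\
      ((N c <= N b)%nat -> wp c2 (fun t => Q (S t)) (S t) N M)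
  | IfR b c c1 c2 => fun t N M => (b < U /\ c < U)%nat /\
      (M b < M c -> wp c1 Q (S t) N M) /\
      (M c <= M b -> wp c2 (fun t => Q (S t)) (S t) N M)
  | While b c body => fun t N M =>
      exists k, (fix it k : assertion :=
        match k with
        | O => fun _ _ _ => False
        | S k' => fun t N M => (b < U /\ c < U)%nat /\
            ((N b < N c)%nat -> wp body (fun t => it k' (S t)) (S t) N M) /\
            ((N c <= N b)%nat -> Q (S (S t)) N M)
        end) k t N M
  end.

Lemma wp_mono c (Q Q' : assertion) : (forall t N M, Q t N M -> Q' t N M) ->
  forall t N M, wp c Q t N M -> wp c Q' t N M.
Proof.
  revert Q Q'; induction c as [i| |c1 IH1 c2 IH2|b c c1 IH1 c2 IH2|b c c1 IH1 c2 IH2|b c body IH];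
    intros Q Q' HQ t N M; cbn [wp].
  - destruct i; cbn [wp_instr]; intuition.
  - apply HQ.
  - apply IH1; intros t' N' M'; apply IH2; exact HQ.
  - intros (Hb & H1 & H2); split; [exact Hb|split; intros Hlt].
    + eapply IH1; [exact HQ|auto].
    + eapply IH2; [|exact (H2 Hlt)]; intros; apply HQ; assumption.
  - intros (Hb & H1 & H2); split; [exact Hb|split; intros Hlt].
    + eapply IH1; [exact HQ|auto].
    + eapply IH2; [|exact (H2 Hlt)]; intros; apply HQ; assumption.
  - intros [k Hk]; exists k; revert t N M Hk; induction k as [|k IHk]; [easy|].
    intros t N M (Hb & H1 & H2); split; [exact Hb|split; intros Hlt].
    + eapply IH; [|exact (H1 Hlt)]; intros; apply IHk; assumption.
    + apply HQ; auto.
Qed.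

(* The first argument of the invariant bounds the number of remaining iterations. *)
Lemma wp_while (I : nat -> assertion) b c body (Q : assertion) k t N M :
  (b < U /\ c < U)%nat -> I k t N M ->
  (forall k t N M, I k t N M -> (N b < N c)%nat ->
     exists k', k = S k' /\ wp body (fun t => I k' (S t)) (S t) N M) ->
  (forall k t N M, I k t N M -> (N c <= N b)%nat -> Q (S (S t)) N M) ->
  wp (While b c body) Q t N M.
Proof.
  intros Hbc HI Hbody Hexit; exists (S k).
  revert t N M HI; induction k as [|k IH]; intros t N M HI;
    (split; [exact Hbc|split; intros Hlt; [|eauto]]);
    destruct (Hbody _ _ _ _ HI Hlt) as (k' & Hk & Hwp); [discriminate|].
  injection Hk as <-.
  eapply wp_mono; [|exact Hwp]; intros t' N' M' HI'; apply IH; exact HI'.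
Qed.

(** * Soundness of the compilation *)

Section Compilation.
Context (prog : list instr).

(** [run] always starts from [init_state]; executions between arbitrary states can be composed. *)
Inductive reach (s : state) : nat -> state -> Prop :=
| reach_refl : reach s 0 s
| reach_step k s' s'' : reach s k s' -> step prog W alpha n p x s' = Some s'' ->
    reach s (S k) s''.

Lemma reach_trans s1 k1 s2 k2 s3 :
  reach s1 k1 s2 -> reach s2 k2 s3 -> reach s1 (k1 + k2) s3.
Proof.
  intros H1 H2; induction H2 as [|k s s' H IH Hs].
  - rewrite Nat.add_0_r; exact H1.
  - rewrite Nat.add_succ_r; econstructor; eassumption.
Qed.

Lemma reach_run k s : reach init_state k s -> run prog W alpha n p x k = Some s.
Proof.
  induction 1 as [|k s' s'' _ IH Hs]; cbn; [reflexivity|]; rewrite IH; exact Hs.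
Qed.

Definition code_at (base : nat) (l : list instr) : Prop :=
  forall i ins, nth_error l i = Some ins -> nth_error prog (base + i) = Some ins.

Lemma code_at_cons base i l :
  code_at base (i :: l) -> nth_error prog base = Some i /\ code_at (base + 1) l.
Proof.
  intros H; split.
  - rewrite <- (Nat.add_0_r base); apply H; reflexivity.
  - intros j ins Hj; replace (base + 1 + j)%nat with (base + S j)%nat by lia.
    apply H; exact Hj.
Qed.

Lemma code_at_app base l1 l2 :
  code_at base (l1 ++ l2) -> code_at base l1 /\ code_at (base + length l1) l2.
Proof.
  intros H; split; intros j ins Hj.
  - apply H; rewrite nth_error_app1; [exact Hj|].
    apply nth_error_Some; congruence.
  - rewrite <- Nat.add_assoc; apply H; rewrite nth_error_app2 by lia.
    rewrite <- Hj; f_equal; lia.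
Qed.

Lemma touch_le l u : (u <= U)%nat -> Forall (fun a => (a < U)%nat) l -> (touch u l <= U)%nat.
Proof.
  intros Hu Hl; revert u Hu; induction Hl as [|a l Ha _ IH]; intros u Hu; [exact Hu|].
  apply IH; lia.
Qed.

Definition words (N : nat -> nat) : Prop := forall a, (N a <= W)%nat.

Lemma words_upd N a v : words N -> (v <= W)%nat -> words (updN N a v).
Proof. intros HN Hv b; unfold updN; destruct (Nat.eqb b a); auto. Qed.

Lemma wp_instr_sound i base Q t N M u :
  nth_error prog base = Some i -> (u <= U)%nat -> words N -> wp_instr i Q t N M ->
  exists N' M' u', reach (mkState base N M u false) 1 (mkState (base + 1) N' M' u' false) /\
    (u' <= U)%nat /\ words N' /\ Q (S t) N' M'.
Proof.
  intros Hi Hu HN Hwp.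
  assert (Hex : exists N' M' u', step prog W alpha n p x (mkState base N M u false) =
    Some (mkState (S base) N' M' u' false) /\ (u' <= U)%nat /\ words N' /\ Q (S t) N' M').
  { unfold step; cbn [halted pc]; rewrite Hi.
    destruct i; cbn [wp_instr mn mr] in *; try contradiction;
      unfold writeN, writeR; cbn [pc mn mr used];
      repeat match goal with H : _ /\ _ |- _ => destruct H end;
      try match goal with |- context [Nat.ltb W ?v] =>
            assert (Hv : (v <= W)%nat) by (assumption || apply HN);
            rewrite (proj2 (Nat.ltb_ge _ _) Hv) end;
      repeat match goal with H : (_ < n)%nat |- _ =>
            rewrite (proj2 (Nat.ltb_lt _ _) H); clear H end;
      cbn [andb];
      (do 3 eexists; split; [reflexivity|]; split; [apply touch_le; auto|];
       split; [|eassumption]);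
      first [exact HN | apply words_upd; assumption]. }
  destruct Hex as (N' & M' & u' & Hs & HQ); exists N', M', u'; split; [|exact HQ].
  rewrite Nat.add_1_r; econstructor; [constructor|exact Hs].
Qed.

Lemma jmp_reach base tgt N M u : nth_error prog base = Some (Jmp tgt) ->
  reach (mkState base N M u false) 1 (mkState tgt N M u false).
Proof.
  intros Hi; econstructor; [constructor|]; unfold step; cbn [halted pc]; rewrite Hi.
  reflexivity.
Qed.

Lemma jmpN_reach base b c tgt N M u : nth_error prog base = Some (JmpNLt b c tgt) ->
  (b < U /\ c < U)%nat -> (u <= U)%nat ->
  exists u', (u' <= U)%nat /\ reach (mkState base N M u false) 1
    (mkState (if Nat.ltb (N b) (N c) then tgt else S base) N M u' false).
Proof.
  intros Hi Hbc Hu; eexists; split; cycle 1.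
  - econstructor; [constructor|]; unfold step; cbn [halted pc]; rewrite Hi; reflexivity.
  - apply touch_le; [exact Hu|]; repeat constructor; tauto.
Qed.

Lemma jmpR_reach base b c tgt N M u : nth_error prog base = Some (JmpRLt b c tgt) ->
  (b < U /\ c < U)%nat -> (u <= U)%nat ->
  exists u', (u' <= U)%nat /\ reach (mkState base N M u false) 1
    (mkState (if Rlt_dec (M b) (M c) then tgt else S base) N M u' false).
Proof.
  intros Hi Hbc Hu; eexists; split; cycle 1.
  - econstructor; [constructor|]; unfold step; cbn [halted pc]; rewrite Hi; cbn.
    destruct (Rlt_dec (M b) (M c)); reflexivity.
  - apply touch_le; [exact Hu|]; repeat constructor; tauto.
Qed.

(** Common part of [IfN] and [IfR], which share their layout: the outcome of the comparison is
    abstracted to [test], and the induction hypotheses for both branches are premises. *)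
Lemma if_sound base c1 c2 (test : bool) tgt Q t N M u u0 :
  (forall base Q t N M u, code_at base (compile base c1) -> (u <= U)%nat -> words N ->
     wp c1 Q t N M -> exists k N' M' u',
     reach (mkState base N M u false) k (mkState (base + size c1) N' M' u' false) /\
     (u' <= U)%nat /\ words N' /\ Q (t + k)%nat N' M') ->
  (forall base Q t N M u, code_at base (compile base c2) -> (u <= U)%nat -> words N ->
     wp c2 Q t N M -> exists k N' M' u',
     reach (mkState base N M u false) k (mkState (base + size c2) N' M' u' false) /\
     (u' <= U)%nat /\ words N' /\ Q (t + k)%nat N' M') ->
  tgt = (base + 2 + size c2)%nat ->
  code_at (base + 1) (compile (base + 1) c2
    ++ Jmp (base + 2 + size c2 + size c1) :: compile (base + 2 + size c2) c1) ->
  (u <= U)%nat -> words N ->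
  reach (mkState base N M u0 false) 1
    (mkState (if test then tgt else S base) N M u false) ->
  (test = true -> wp c1 Q (S t) N M) ->
  (test = false -> wp c2 (fun t => Q (S t)) (S t) N M) ->
  exists k N' M' u',
    reach (mkState base N M u0 false) k
      (mkState (base + (2 + size c2 + size c1)) N' M' u' false) /\
    (u' <= U)%nat /\ words N' /\ Q (t + k)%nat N' M'.
Proof.
  intros S1 S2 -> Hcode Hu HN Hr Ht Hf.
  apply code_at_app in Hcode as [Hc2 Hcode]; rewrite compile_length in Hcode.
  apply code_at_cons in Hcode as [Hj Hc1].
  replace (base + 1 + size c2 + 1)%nat with (base + 2 + size c2)%nat in Hc1 by lia.
  destruct test.
  - destruct (S1 _ _ _ _ _ _ Hc1 Hu HN (Ht eq_refl)) as (k & N' & M' & u' & Hr' & Hu' & HN' & HQ).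
    exists (1 + k)%nat, N', M', u'; split; [|split; [exact Hu'|split; [exact HN'|]]].
    + eapply reach_trans; [exact Hr|].
      replace (base + (2 + size c2 + size c1))%nat
        with (base + 2 + size c2 + size c1)%nat by lia; exact Hr'.
    + replace (t + (1 + k))%nat with (S t + k)%nat by lia; exact HQ.
  - rewrite <- (Nat.add_1_r base) in Hr.
    destruct (S2 _ _ _ _ _ _ Hc2 Hu HN (Hf eq_refl)) as (k & N' & M' & u' & Hr' & Hu' & HN' & HQ).
    exists (1 + (k + 1))%nat, N', M', u'; split; [|split; [exact Hu'|split; [exact HN'|]]].
    + eapply reach_trans; [exact Hr|]; eapply reach_trans; [exact Hr'|].
      replace (base + (2 + size c2 + size c1))%nat
        with (base + 2 + size c2 + size c1)%nat by lia; apply jmp_reach; exact Hj.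
    + replace (t + (1 + (k + 1)))%nat with (S (S t + k)) by lia; exact HQ.
Qed.

Lemma wp_sound c base Q t N M u :
  code_at base (compile base c) -> (u <= U)%nat -> words N -> wp c Q t N M ->
  exists k N' M' u',
    reach (mkState base N M u false) k (mkState (base + size c) N' M' u' false) /\
    (u' <= U)%nat /\ words N' /\ Q (t + k)%nat N' M'.
Proof.
  revert base Q t N M u;
    induction c as [i| |c1 IH1 c2 IH2|b c c1 IH1 c2 IH2|b c c1 IH1 c2 IH2|b c body IH];
    intros base Q t N M u Hcode Hu HN Hwp; cbn [compile size wp] in *.
  - apply code_at_cons in Hcode as [Hi _].
    destruct (wp_instr_sound _ _ _ _ _ _ _ Hi Hu HN Hwp) as (N' & M' & u' & Hr & Hu' & HQ).
    exists 1%nat, N', M', u'; rewrite (Nat.add_1_r t); auto.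
  - exists 0%nat, N, M, u; rewrite !Nat.add_0_r; repeat split; auto; constructor.
  - apply code_at_app in Hcode as [Hc1 Hc2]; rewrite compile_length in Hc2.
    destruct (IH1 _ _ _ _ _ _ Hc1 Hu HN Hwp) as (k1 & N1 & M1 & u1 & Hr1 & Hu1 & HN1 & HQ1).
    destruct (IH2 _ _ _ _ _ _ Hc2 Hu1 HN1 HQ1) as (k2 & N2 & M2 & u2 & Hr2 & Hu2 & HN2 & HQ2).
    exists (k1 + k2)%nat, N2, M2, u2; split; [|split; [exact Hu2|split; [exact HN2|]]].
    + rewrite Nat.add_assoc; eapply reach_trans; eassumption.
    + rewrite Nat.add_assoc; exact HQ2.
  - apply code_at_cons in Hcode as [Hi Hcode]; destruct Hwp as (Hbc & Ht & Hf).
    destruct (jmpN_reach _ _ _ _ N M u Hi Hbc Hu) as (u1 & Hu1 & Hr).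
    eapply (if_sound _ _ _ (Nat.ltb (N b) (N c))); try eassumption; try reflexivity.
    + intros Hlt; apply Ht, Nat.ltb_lt; exact Hlt.
    + intros Hge; apply Hf, Nat.ltb_ge; exact Hge.
  - apply code_at_cons in Hcode as [Hi Hcode]; destruct Hwp as (Hbc & Ht & Hf).
    destruct (jmpR_reach _ _ _ _ N M u Hi Hbc Hu) as (u1 & Hu1 & Hr).
    eapply (if_sound _ _ _ (if Rlt_dec (M b) (M c) then true else false));
      try eassumption; try reflexivity.
    + destruct (Rlt_dec (M b) (M c)); exact Hr.
    + destruct (Rlt_dec (M b) (M c)); [auto|discriminate].
    + destruct (Rlt_dec (M b) (M c)); [discriminate|intros _; apply Hf; lra].
  - apply code_at_cons in Hcode as [Hi Hcode].
    apply code_at_cons in Hcode as [Hj Hcode].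
    apply code_at_app in Hcode as [Hbody Hback]; rewrite compile_length in Hback.
    apply code_at_cons in Hback as [Hback _].
    replace (base + 1 + 1)%nat with (base + 2)%nat in * by lia.
    destruct Hwp as [k Hk]; revert t N M u Hu HN Hk.
    induction k as [|k IHk]; intros t N M u Hu HN Hk; [destruct Hk|].
    destruct Hk as (Hbc & Ht & Hf).
    destruct (jmpN_reach _ _ _ _ N M u Hi Hbc Hu) as (u1 & Hu1 & Hr).
    destruct (Nat.ltb_spec (N b) (N c)) as [Hlt|Hge].
    + destruct (IH _ _ _ _ _ _ Hbody Hu1 HN (Ht Hlt)) as (k1 & N1 & M1 & u2 & Hr1 & Hu2 & HN1 & HQ1).
      destruct (IHk _ _ _ _ Hu2 HN1 HQ1) as (k2 & N2 & M2 & u3 & Hr2 & Hu3 & HN2 & HQ2).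
      exists (1 + (k1 + (1 + k2)))%nat, N2, M2, u3; split; [|split; [exact Hu3|split; [exact HN2|]]].
      * eapply reach_trans; [exact Hr|]; eapply reach_trans; [exact Hr1|].
        eapply reach_trans; [apply jmp_reach; exact Hback|exact Hr2].
      * replace (t + (1 + (k1 + (1 + k2))))%nat with (S (S t + k1) + k2)%nat by lia.
        exact HQ2.
    + rewrite <- (Nat.add_1_r base) in Hr.
      exists (1 + 1)%nat, N, M, u1; split; [|split; [exact Hu1|split; [exact HN|]]].
      * eapply reach_trans; [exact Hr|].
        replace (base + (3 + size body))%nat with (base + 3 + size body)%nat by lia.
        apply jmp_reach; exact Hj.
      * replace (t + (1 + 1))%nat with (S (S t)) by lia; auto.
Qed.

End Compilation.

(** The strict inequality leaves one step for the final [Halt]. *)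
Lemma wp_solves c time :
  wp c (fun t N M => (t < time)%nat /\ optimal alpha n p x N (M 0%nat))
    0%nat (fun _ => 0%nat) (fun _ => 0) ->
  solves_within (compile 0 c ++ Halt :: nil) W alpha n p x time U.
Proof.
  intros Hwp; set (prog := compile 0 c ++ Halt :: nil).
  assert (Hcode : code_at prog 0 prog) by (intros i ins Hi; exact Hi).
  apply code_at_app in Hcode as [Hc Hh]; apply code_at_cons in Hh as [Hh _].
  rewrite compile_length in Hh.
  destruct (wp_sound prog c 0%nat _ _ _ _ 0%nat Hc (Nat.le_0_l _) (fun _ => Nat.le_0_l _) Hwp)
    as (k & N & M & u & Hr & Hu & _ & Ht & Hopt).
  exists (S k), (mkState (0 + size c) N M u true); split.
  - apply reach_run; econstructor; [exact Hr|].
    unfold step; cbn [halted pc]; rewrite Hh; reflexivity.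
  - exact (conj eq_refl (conj Ht (conj Hu Hopt))).
Qed.

End WeakestPrecondition.

(** * Dispersion along a sorted Pareto front *)

Section Dispersion.
Context (alpha : R) (Halpha : 0 < alpha) (n : nat) (x : nat -> point) (Hx : pareto n x).

Lemma dpow_sym y z : dpow alpha y z = dpow alpha z y.
Proof.
  assert (H : Defs.dist y z = Defs.dist z y) by (unfold Defs.dist; f_equal; ring).
  unfold dpow; rewrite H; reflexivity.
Qed.

Lemma dpow_refl y : dpow alpha y y = 0.
Proof.
  unfold dpow; destruct (Req_EM_T (Defs.dist y y) 0) as [_|Hne]; [reflexivity|].
  exfalso; apply Hne; unfold Defs.dist; rewrite <- sqrt_0; f_equal; ring.
Qed.

Lemma dpow_nonneg y z : 0 <= dpow alpha y z.
Proof.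
  unfold dpow; destruct (Req_EM_T (Defs.dist y z) 0); [lra|apply Rlt_le, exp_pos].
Qed.

(** Distance zero is split off because [Rpower] behaves as a power only on positive bases. *)
Lemma dpow_le_of_dist y z y' z' : Defs.dist y z <= Defs.dist y' z' ->
  dpow alpha y z <= dpow alpha y' z'.
Proof.
  intros Hd; assert (H0 : 0 <= Defs.dist y z) by apply sqrt_pos.
  unfold dpow at 1; destruct (Req_EM_T (Defs.dist y z) 0) as [_|Hne]; [apply dpow_nonneg|].
  unfold dpow; destruct (Req_EM_T (Defs.dist y' z') 0) as [H'|_]; [lra|].
  apply Rle_Rpower_l; lra.
Qed.

Lemma pareto_snd i j : (i < n)%nat -> (j < n)%nat -> fst (x i) <= fst (x j) ->
  snd (x j) <= snd (x i).
Proof.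
  intros Hi Hj Hle; destruct (Nat.eq_dec i j) as [->|Hne]; [lra|].
  destruct (Hx i j Hi Hj Hne) as [[]|[]]; lra.
Qed.

Lemma pareto_fst_inj i j : (i < n)%nat -> (j < n)%nat -> fst (x i) = fst (x j) -> i = j.
Proof.
  intros Hi Hj He; destruct (Nat.eq_dec i j) as [|Hne]; [assumption|].
  destruct (Hx i j Hi Hj Hne) as [[]|[]]; lra.
Qed.

(** On a front the second coordinate falls as the first rises, so both coordinate differences grow
    with the interval. *)
Lemma dpow_mono a b c d : (a < n)%nat -> (b < n)%nat -> (c < n)%nat -> (d < n)%nat ->
  fst (x a) <= fst (x b) -> fst (x b) <= fst (x c) -> fst (x c) <= fst (x d) ->
  dpow alpha (x b) (x c) <= dpow alpha (x a) (x d).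
Proof.
  intros Ha Hb Hc Hd Hab Hbc Hcd; apply dpow_le_of_dist, sqrt_le_1_alt.
  pose proof (pareto_snd _ _ Ha Hb Hab); pose proof (pareto_snd _ _ Hb Hc Hbc).
  pose proof (pareto_snd _ _ Hc Hd Hcd); nra.
Qed.

Lemma dpow_pos i j : (i < n)%nat -> (j < n)%nat -> i <> j -> 0 < dpow alpha (x i) (x j).
Proof.
  intros Hi Hj Hne; unfold dpow.
  destruct (Req_EM_T (Defs.dist (x i) (x j)) 0) as [H0|_]; [exfalso|apply exp_pos].
  pose proof (pow2_ge_0 (fst (x i) - fst (x j))).
  pose proof (pow2_ge_0 (snd (x i) - snd (x j))).
  apply sqrt_eq_0 in H0; [|lra].
  destruct (Hx i j Hi Hj Hne) as [[]|[]]; nra.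
Qed.

Lemma finite_min {A : Type} (f : A -> R) (l : list A) : l <> nil ->
  exists a, In a l /\ forall b, In b l -> f a <= f b.
Proof.
  induction l as [|a l IH]; [easy|intros _].
  destruct l as [|b l]; [exists a; split; [now left|intros c [->|[]]; lra]|].
  destruct IH as (c & Hc & Hmin); [easy|].
  destruct (Rle_dec (f a) (f c)) as [Hle|Hgt].
  - exists a; split; [now left|]; intros d [->|Hd]; [lra|].
    specialize (Hmin d Hd); lra.
  - exists c; split; [now right|]; intros d [->|Hd]; [lra|auto].
Qed.

Lemma min_pairwise_exists p sel : (2 <= p)%nat -> exists v, min_pairwise alpha x p sel v.
Proof.
  intros Hp.
  set (f := fun ij : nat * nat => dpow alpha (x (sel (fst ij))) (x (sel (snd ij)))).
  set (l := filter (fun ij => Nat.ltb (fst ij) (snd ij)) (list_prod (seq 0 p) (seq 0 p))).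
  assert (Hl : forall i j, In (i, j) l <-> (i < j < p)%nat).
  { intros i j; unfold l; rewrite filter_In, in_prod_iff, !in_seq; cbn [fst snd].
    rewrite Nat.ltb_lt; lia. }
  destruct (finite_min f l) as ([i j] & Hij & Hmin).
  - intros E; assert (H01 : In (0, 1)%nat l) by (apply Hl; lia).
    rewrite E in H01; destruct H01.
  - apply Hl in Hij; exists (f (i, j)); split.
    + intros i' j' Hlt Hj'; apply (Hmin (i', j')), Hl; lia.
    + exists i, j; repeat split; lia.
Qed.

(** Attainment comes for free: the minimum [w] of [sel] satisfies [v <= w] by the lower bound, and
    [w <= v] by the upper bound applied to [sel] itself. *)
Lemma optimal_intro p sel v : (2 <= p)%nat -> feasible n p sel ->
  (forall i j, (i < j)%nat -> (j < p)%nat -> v <= dpow alpha (x (sel i)) (x (sel j))) ->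
  (forall sel' v', feasible n p sel' -> min_pairwise alpha x p sel' v' -> v' <= v) ->
  optimal alpha n p x sel v.
Proof.
  intros Hp Hf Hv Hub; destruct (min_pairwise_exists p sel Hp) as [w Hw].
  assert (Hwv : v = w).
  { apply Rle_antisym; [|exact (Hub _ _ Hf Hw)].
    destruct Hw as (_ & i & j & Hij & Hj & ->); auto. }
  subst w; split; [exact Hf|split; [exact Hw|exact Hub]].
Qed.

Lemma min_pairwise_all p sel v i j : min_pairwise alpha x p sel v ->
  (i < p)%nat -> (j < p)%nat -> i <> j -> v <= dpow alpha (x (sel i)) (x (sel j)).
Proof.
  intros [Hv _] Hi Hj Hne; destruct (Nat.lt_gt_cases i j) as [H _].
  destruct (H Hne) as [Hlt|Hgt]; [auto|].
  rewrite dpow_sym; auto.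
Qed.

Lemma min_pairwise_pos p sel v : feasible n p sel -> min_pairwise alpha x p sel v -> 0 < v.
Proof.
  intros [Hlt Hinj] (_ & i & j & Hij & Hj & ->); apply dpow_pos.
  - apply Hlt; lia.
  - apply Hlt; lia.
  - intros He; apply Hinj in He; lia.
Qed.

(** * Chains and levels along sorted positions *)

Section Sorted.
Context (A : nat -> nat) (HAn : forall j, (j < n)%nat -> (A j < n)%nat).
Context (HAlt : forall i j, (i < j)%nat -> (j < n)%nat -> fst (x (A i)) < fst (x (A j))).

Definition gap (i j : nat) : R := dpow alpha (x (A i)) (x (A j)).

(* [chain v m i]: some [m + 1] increasing positions end at [i], with consecutive
   gaps at least [v]. *)
Inductive chain (v : R) : nat -> nat -> Prop :=
| chain_start i : chain v 0 i
| chain_step m j i : chain v m j -> (j < i)%nat -> v <= gap j i -> chain v (S m) i.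

Lemma sorted_le i j : (i <= j)%nat -> (j < n)%nat -> fst (x (A i)) <= fst (x (A j)).
Proof.
  intros Hij Hj; destruct (Nat.eq_dec i j) as [->|Hne]; [lra|].
  apply Rlt_le, HAlt; lia.
Qed.

Lemma gap_mono a b c d : (a <= b)%nat -> (b <= c)%nat -> (c <= d)%nat -> (d < n)%nat ->
  gap b c <= gap a d.
Proof.
  intros; apply dpow_mono; try (apply HAn; lia); apply sorted_le; lia.
Qed.

Lemma sorted_inj i j : (i < n)%nat -> (j < n)%nat -> A i = A j -> i = j.
Proof.
  intros Hi Hj He; destruct (Nat.lt_total i j) as [H|[H|H]]; [|exact H|];
    apply HAlt in H; auto; rewrite He in H; lra.
Qed.

Lemma gap_pos i j : (i < j)%nat -> (j < n)%nat -> 0 < gap i j.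
Proof.
  intros Hij Hj; apply dpow_pos; try (apply HAn; lia).
  intros He; apply sorted_inj in He; lia.
Qed.

Lemma gap_refl i : gap i i = 0.
Proof. apply dpow_refl. Qed.

(** Moving the last point to the right only widens the last gap. *)
Lemma chain_mono v m i j : chain v (S m) i -> (i <= j)%nat -> (j < n)%nat -> chain v (S m) j.
Proof.
  intros Hc Hij Hj; inversion Hc as [|m' k i' Hc' Hki Hv]; subst.
  apply (chain_step v m k j Hc'); [lia|].
  eapply Rle_trans; [exact Hv|apply gap_mono; lia].
Qed.

(** Selections come unordered. Induction on a bound of the positions removes the largest one at each
    step, which sorts the list without a sorting function. *)
Lemma chain_of_list v b : forall m l, NoDup l -> length l = S m ->
  (forall i, In i l -> (i < b)%nat) -> (b <= n)%nat ->
  (forall i j, In i l -> In j l -> i <> j -> v <= gap i j) ->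
  exists j, In j l /\ chain v m j.
Proof.
  induction b as [|b IH]; intros m l Hnd Hlen Hlt Hbn Hv.
  - destruct l as [|i l]; [discriminate|]; specialize (Hlt i (or_introl eq_refl)); lia.
  - destruct (in_dec Nat.eq_dec b l) as [Hb|Hb].
    + destruct m as [|m]; [exists b; split; [exact Hb|constructor]|].
      destruct (in_split b l Hb) as (l1 & l2 & ->).
      apply NoDup_remove in Hnd as [Hnd Hnb].
      assert (Hin : forall i, In i (l1 ++ l2) -> In i (l1 ++ b :: l2)).
      { intros i Hi; apply in_app_iff in Hi; apply in_app_iff; cbn; tauto. }
      assert (Hltb : forall i, In i (l1 ++ l2) -> (i < b)%nat).
      { intros i Hi; specialize (Hlt i (Hin i Hi)).
        assert (i <> b) by (intros ->; auto); lia. }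
      destruct (IH m (l1 ++ l2) Hnd) as (j & Hj & Hc); auto; [|lia|].
      * rewrite length_app in *; cbn in Hlen; lia.
      * exists b; split; [exact Hb|].
        apply (chain_step v m j b Hc); [auto|].
        apply Hv; auto; specialize (Hltb j Hj); lia.
    + apply IH; auto; [|lia]; intros i Hi; specialize (Hlt i Hi).
      assert (i <> b) by (intros ->; auto); lia.
Qed.

Lemma chain_of_selection p sel v :
  (forall i, (i < n)%nat -> exists j, (j < n)%nat /\ A j = i) ->
  (2 <= p)%nat -> feasible n p sel -> min_pairwise alpha x p sel v ->
  chain v (p - 1) (n - 1).
Proof.
  intros Hsurj Hp [Hlt Hinj] Hv.
  (* Finite choice, by induction on [p], of the sorted positions of the selected points. *)
  assert (Hpos : exists pos, forall i, (i < p)%nat -> (pos i < n)%nat /\ A (pos i) = sel i).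
  { clear Hp Hinj Hv; induction p as [|p IHp]; [exists (fun _ => 0%nat); lia|].
    destruct IHp as [pos Hpos]; [auto|].
    destruct (Hsurj (sel p)) as (j & Hj & HAj); [auto|].
    exists (fun i => if Nat.eqb i p then j else pos i); intros i Hi.
    destruct (Nat.eqb_spec i p) as [->|Hne]; [auto|apply Hpos; lia]. }
  destruct Hpos as [pos Hpos].
  destruct (chain_of_list v n (p - 1) (map pos (seq 0 p))) as (j & Hj & Hc); auto.
  - apply NoDup_map_NoDup_ForallPairs; [|apply seq_NoDup].
    intros i j Hi Hj He; apply in_seq in Hi; apply in_seq in Hj.
    apply Hinj; [lia|lia|].
    rewrite <- (proj2 (Hpos i ltac:(lia))), <- (proj2 (Hpos j ltac:(lia))), He; reflexivity.
  - rewrite length_map, length_seq; lia.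
  - intros i Hi; apply in_map_iff in Hi as (k & <- & Hk); apply in_seq in Hk.
    apply Hpos; lia.
  - intros i j Hi Hj Hne.
    apply in_map_iff in Hi as (k & <- & Hk); apply in_seq in Hk.
    apply in_map_iff in Hj as (l & <- & Hl); apply in_seq in Hl.
    unfold gap; rewrite (proj2 (Hpos k ltac:(lia))), (proj2 (Hpos l ltac:(lia))).
    apply (min_pairwise_all p sel v); [exact Hv|lia|lia|congruence].
  - replace (p - 1)%nat with (S (p - 2)) in * by lia.
    apply in_map_iff in Hj as (k & <- & Hk); apply in_seq in Hk.
    destruct (Hpos k ltac:(lia)) as [Hk' _].
    apply (chain_mono v _ (pos k)); [exact Hc|lia|lia].
Qed.

(* [c] is the largest threshold for which some chain of [m + 1] points ends at [i], or [0]
   if there is none. *)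
Definition level (m i : nat) (c : R) : Prop :=
  0 <= c /\ forall v, 0 < v -> (v <= c <-> chain v m i).

(** The best predecessor is the leftmost position. At [i = 0] the gap is [0], which is also the
    convention for having no chain. *)
Lemma level_one i : (i < n)%nat -> level 1 i (gap 0 i).
Proof.
  intros Hi; split; [apply dpow_nonneg|]; intros v Hv; split.
  - intros Hle; destruct i as [|i]; [rewrite gap_refl in Hle; lra|].
    apply (chain_step v 0 0); [constructor|lia|exact Hle].
  - inversion 1; subst; eapply Rle_trans; [eassumption|apply gap_mono; lia].
Qed.

Lemma level_zero m c : level (S m) 0 c -> c = 0.
Proof.
  intros [H0 H]; destruct (Rle_lt_or_eq_dec _ _ H0) as [Hlt|He]; [|auto].
  assert (Hc : chain c (S m) 0) by (apply H; lra).
  inversion Hc; lia.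
Qed.

Lemma level_at_zero m : level (S m) 0 0.
Proof.
  split; [lra|]; intros v Hv; split; [lra|inversion 1; lia].
Qed.

Lemma level_mono m i j c d : level (S m) i c -> level (S m) j d ->
  (i <= j)%nat -> (j < n)%nat -> c <= d.
Proof.
  intros [Hc0 Hc] [Hd0 Hd] Hij Hj.
  destruct (Rle_lt_or_eq_dec _ _ Hc0) as [Hlt|He]; [|lra].
  apply Hd; [exact Hlt|]; apply (chain_mono c m i); auto; apply Hc; lra.
Qed.

(* [j] is the crossing point: levels are below the gaps to [i] before [j] and above
   from [j] on, so the best predecessor of [i] is [j - 1] or [j]. *)
Lemma level_step m i j (c : nat -> R) :
  (forall k, (k <= i)%nat -> level (S m) k (c k)) ->
  (1 <= j <= i)%nat -> (i < n)%nat ->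
  gap j i <= c j -> c (j - 1)%nat < gap (j - 1) i ->
  level (S (S m)) i (Rmax (gap j i) (c (j - 1)%nat)).
Proof.
  intros Hc Hj Hi Hge Hlt; split.
  - eapply Rle_trans; [apply (dpow_nonneg (x (A j)) (x (A i)))|apply Rmax_l].
  - intros v Hv; split.
    (* A threshold up to [gap j i <= c j] is served by the predecessor [j]; otherwise
       [v <= c (j - 1) < gap (j - 1) i], and [j - 1] serves. *)
    + intros Hle; destruct (Rle_dec v (gap j i)) as [H|H].
      * destruct (Nat.eq_dec j i) as [->|Hne]; [rewrite gap_refl in H; lra|].
        apply (chain_step v _ j); [|lia|exact H].
        apply (Hc j); [lia|lra|lra].
      * assert (H' : v <= c (j - 1)%nat)
          by (revert Hle; unfold Rmax; destruct Rle_dec; lra).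
        apply (chain_step v _ (j - 1)); [|lia|lra].
        apply (Hc (j - 1)%nat); [lia|lra|lra].
    (* A predecessor [k < j] is limited by its level, at most [c (j - 1)]; one from [j] on is
       limited by its gap to [i], at most [gap j i]. *)
    + inversion 1 as [|m' k i' Hk Hki Hg]; subst.
      destruct (Nat.lt_ge_cases k j) as [Hkj|Hkj].
      * eapply Rle_trans; [|apply Rmax_r]; apply Rle_trans with (c k).
        -- apply (Hc k); [lia|exact Hv|exact Hk].
        -- apply (level_mono m k (j - 1)); try apply Hc; lia.
      * eapply Rle_trans; [|apply Rmax_l]; eapply Rle_trans; [exact Hg|].
        apply gap_mono; lia.
Qed.

(* The last clause makes the choice [g] greedy: no chain gets ahead of it. *)
Definition greedy (v : R) (i k : nat) (g : nat -> nat) : Prop :=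
  g 0%nat = 0%nat /\
  (forall a b, (a < b)%nat -> (b < k)%nat -> (g a < g b)%nat /\ v <= gap (g a) (g b)) /\
  (forall a, (a < k)%nat -> (g a < i)%nat) /\
  (forall m j, chain v m j -> (j < i)%nat -> (m < k)%nat /\ (g m <= j)%nat).

Lemma greedy_start v : greedy v 1 1 (fun _ => 0%nat).
Proof.
  split; [reflexivity|split; [lia|split; [lia|]]].
  intros m j Hc Hj; destruct Hc; lia.
Qed.

Lemma greedy_skip v i k g : (1 <= k)%nat -> greedy v i k g -> (i < n)%nat ->
  gap (g (k - 1)%nat) i < v -> greedy v (S i) k g.
Proof.
  intros Hk (H0 & Hinc & Hlt & Hch) Hi Hv.
  split; [exact H0|split; [exact Hinc|split; [intros a Ha; specialize (Hlt a Ha); lia|]]].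
  intros m j Hc Hj; destruct (Nat.eq_dec j i) as [->|Hne]; [|apply Hch; [exact Hc|lia]].
  inversion Hc as [|m' j' i' Hc' Hji Hg]; subst; [rewrite H0; lia|].
  destruct (Hch _ _ Hc' Hji) as [Hm Hgm].
  (* A chain of [k + 1] points ending at [i] would have its last but one point at or right of
     [g (k - 1)], hence too close to [i]. *)
  destruct (Nat.eq_dec (S m') k) as [<-|Hmk].
  - exfalso; cbn in Hv; rewrite Nat.sub_0_r in Hv.
    assert (gap j' i <= gap (g m') i) by (apply gap_mono; lia); lra.
  - assert (Hsm : (S m' < k)%nat) by lia; specialize (Hlt _ Hsm); lia.
Qed.

Lemma greedy_take v i k g : (1 <= k)%nat -> greedy v i k g -> (i < n)%nat ->
  v <= gap (g (k - 1)%nat) i -> greedy v (S i) (S k) (updN g k i).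
Proof.
  intros Hk (H0 & Hinc & Hlt & Hch) Hi Hv.
  assert (Hold : forall a, (a < k)%nat -> updN g k i a = g a)
    by (intros a Ha; unfold updN; destruct (Nat.eqb_spec a k); [lia|reflexivity]).
  assert (Hnew : updN g k i k = i) by (unfold updN; rewrite Nat.eqb_refl; reflexivity).
  split; [rewrite Hold by lia; exact H0|split; [|split]].
  - intros a b Hab Hb; destruct (Nat.eq_dec b k) as [->|Hne].
    + rewrite Hnew, Hold by lia; split; [apply Hlt; lia|].
      eapply Rle_trans; [exact Hv|]; apply gap_mono; try lia.
      * destruct (Nat.eq_dec a (k - 1)) as [->|Ha]; [lia|].
        apply Nat.lt_le_incl, Hinc; lia.
      * apply Nat.lt_le_incl, Hlt; lia.
    + rewrite !Hold by lia; apply Hinc; lia.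
  - intros a Ha; destruct (Nat.eq_dec a k) as [->|Hne]; [lia|].
    rewrite Hold by lia; specialize (Hlt a ltac:(lia)); lia.
  - intros m j Hc Hj; destruct (Nat.eq_dec j i) as [->|Hne].
    + assert (Hm : (m <= k)%nat).
      { inversion Hc as [|m' j' i' Hc' Hji Hg]; subst; [lia|].
        destruct (Hch _ _ Hc' Hji); lia. }
      split; [lia|]; destruct (Nat.eq_dec m k) as [->|Hmk]; [lia|].
      rewrite Hold by lia; apply Nat.lt_le_incl, Hlt; lia.
    + destruct (Hch m j Hc ltac:(lia)) as [Hm Hg]; rewrite Hold by lia; lia.
Qed.

(** A chain of [p] points with gaps [v] exists, and greedy is never behind it, so [p <= k]. Greedy
    may take more points than [p]; the first [p] are kept. *)
Lemma greedy_optimal p v k g :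
  (forall i, (i < n)%nat -> exists j, (j < n)%nat /\ A j = i) ->
  (2 <= p)%nat -> (p <= n)%nat -> level (p - 1) (n - 1) v -> greedy v n k g ->
  (p <= k)%nat /\ forall sel, (forall i, (i < p)%nat -> sel i = A (g i)) ->
  optimal alpha n p x sel v.
Proof.
  intros Hsurj Hp Hpn [_ Hlev] (_ & Hinc & Hlt & Hch).
  (* [level] speaks of positive thresholds only. Since [p <= n], the identity is a selection, and
     its positive minimum lies below [v]. *)
  assert (Hvpos : 0 < v).
  { assert (Hf : feasible n p (fun i => i)) by (split; intros; lia || assumption).
    destruct (min_pairwise_exists p (fun i => i) Hp) as [w Hw].
    pose proof (min_pairwise_pos _ _ _ Hf Hw) as Hw0.
    apply Rlt_le_trans with w; [exact Hw0|]; apply Hlev; [exact Hw0|].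
    exact (chain_of_selection _ _ _ Hsurj Hp Hf Hw). }
  assert (Hk : (p <= k)%nat).
  { assert (Hc : chain v (p - 1) (n - 1)) by (apply Hlev; [exact Hvpos|lra]).
    destruct (Hch _ _ Hc); lia. }
  split; [exact Hk|]; intros sel Hsel; apply optimal_intro; [exact Hp| | |].
  - split.
    + intros i Hi; rewrite Hsel by exact Hi; apply HAn, Hlt; lia.
    + intros i j Hi Hj He; rewrite !Hsel in He by assumption.
      apply sorted_inj in He; [|apply Hlt; lia|apply Hlt; lia].
      destruct (Nat.lt_total i j) as [H|[H|H]]; [|exact H|];
        apply Hinc in H; lia.
  - intros i j Hij Hj; rewrite !Hsel by lia; apply Hinc; lia.
  - intros sel' v' Hf Hm; apply Hlev; [exact (min_pairwise_pos _ _ _ Hf Hm)|].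
    exact (chain_of_selection _ _ _ Hsurj Hp Hf Hm).
Qed.

End Sorted.
End Dispersion.

(** * Symbolic execution *)

Lemma updN_eq f a v b : b = a -> updN f a v b = v.
Proof. intros ->; unfold updN; rewrite Nat.eqb_refl; reflexivity. Qed.

Lemma updN_ne f a v b : b <> a -> updN f a v b = f b.
Proof. intros H; unfold updN; destruct (Nat.eqb_spec b a); [contradiction|reflexivity]. Qed.

Lemma updR_eq f a v b : b = a -> updR f a v b = v.
Proof. intros ->; unfold updR; rewrite Nat.eqb_refl; reflexivity. Qed.

Lemma updR_ne f a v b : b <> a -> updR f a v b = f b.
Proof. intros H; unfold updR; destruct (Nat.eqb_spec b a); [contradiction|reflexivity]. Qed.

Section Rules.
Context (U W : nat) (alpha : R) (n p : nat) (x : nat -> point).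
Notation wp := (wp U W alpha n p x).

Lemma wp_Seq c1 c2 Q t N M : wp c1 (wp c2 Q) t N M -> wp (Seq c1 c2) Q t N M.
Proof. exact (fun H => H). Qed.

Lemma wp_Skip (Q : assertion) t N M : Q t N M -> wp Skip Q t N M.
Proof. exact (fun H => H). Qed.

Lemma wp_IfN b c c1 c2 Q t N M : (b < U /\ c < U)%nat ->
  ((N b < N c)%nat -> wp c1 Q (S t) N M) ->
  ((N c <= N b)%nat -> wp c2 (fun t => Q (S t)) (S t) N M) ->
  wp (IfN b c c1 c2) Q t N M.
Proof. exact (fun H1 H2 H3 => conj H1 (conj H2 H3)). Qed.

Lemma wp_IfR b c c1 c2 Q t N M : (b < U /\ c < U)%nat ->
  (M b < M c -> wp c1 Q (S t) N M) ->
  (M c <= M b -> wp c2 (fun t => Q (S t)) (S t) N M) ->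
  wp (IfR b c c1 c2) Q t N M.
Proof. exact (fun H1 H2 H3 => conj H1 (conj H2 H3)). Qed.

Lemma wp_NConst a k (Q : assertion) t N M : (a < U)%nat -> (k <= W)%nat ->
  Q (S t) (updN N a k) M -> wp (NConst a k) Q t N M.
Proof. exact (fun H1 H2 H3 => conj H1 (conj H2 H3)). Qed.

Lemma wp_ReadN a (Q : assertion) t N M : (a < U)%nat -> (n <= W)%nat ->
  Q (S t) (updN N a n) M -> wp (ReadN a) Q t N M.
Proof. exact (fun H1 H2 H3 => conj H1 (conj H2 H3)). Qed.

Lemma wp_ReadP a (Q : assertion) t N M : (a < U)%nat -> (p <= W)%nat ->
  Q (S t) (updN N a p) M -> wp (ReadP a) Q t N M.
Proof. exact (fun H1 H2 H3 => conj H1 (conj H2 H3)). Qed.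

(** The result is a separate variable so that reads of memory are evaluated before the value enters
    the next state; the loads and stores name addresses likewise. *)
Lemma wp_NArith o a b c v (Q : assertion) t N M : (a < U /\ b < U /\ c < U)%nat ->
  nopf o (N b) (N c) = v -> (v <= W)%nat ->
  Q (S t) (updN N a v) M -> wp (NArith o a b c) Q t N M.
Proof. intros H1 <- H2 H3; exact (conj H1 (conj H2 H3)). Qed.

Lemma wp_NLoad a b ad v (Q : assertion) t N M : (a < U /\ b < U)%nat ->
  N b = ad -> (ad < U)%nat -> N ad = v ->
  Q (S t) (updN N a v) M -> wp (NLoad a b) Q t N M.
Proof. intros [H1 H2] <- H3 <- H4; exact (conj (conj H1 (conj H2 H3)) H4). Qed.

Lemma wp_NStore a b ad v (Q : assertion) t N M : (a < U /\ b < U)%nat ->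
  N a = ad -> (ad < U)%nat -> N b = v ->
  Q (S t) (updN N ad v) M -> wp (NStore a b) Q t N M.
Proof. intros [H1 H2] <- H3 <- H4; exact (conj (conj H1 (conj H2 H3)) H4). Qed.

Lemma wp_RZero a (Q : assertion) t N M : (a < U)%nat ->
  Q (S t) N (updR M a 0) -> wp (RZero a) Q t N M.
Proof. exact (fun H1 H2 => conj H1 H2). Qed.

Lemma wp_RArith o a b c (Q : assertion) t N M : (a < U /\ b < U /\ c < U)%nat ->
  Q (S t) N (updR M a (ropf o (M b) (M c))) -> wp (RArith o a b c) Q t N M.
Proof. exact (fun H1 H2 => conj H1 H2). Qed.

Lemma wp_RLoad a b ad (Q : assertion) t N M : (a < U /\ b < U)%nat ->
  N b = ad -> (ad < U)%nat ->
  Q (S t) N (updR M a (M ad)) -> wp (RLoad a b) Q t N M.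
Proof. intros [H1 H2] <- H3 H4; exact (conj (conj H1 (conj H2 H3)) H4). Qed.

Lemma wp_RStore a b ad (Q : assertion) t N M : (a < U /\ b < U)%nat ->
  N a = ad -> (ad < U)%nat ->
  Q (S t) N (updR M ad (M b)) -> wp (RStore a b) Q t N M.
Proof. intros [H1 H2] <- H3 H4; exact (conj (conj H1 (conj H2 H3)) H4). Qed.

Lemma wp_ReadX a b i (Q : assertion) t N M : (a < U /\ b < U)%nat -> N b = i -> (i < n)%nat ->
  Q (S t) N (updR M a (fst (x i))) -> wp (ReadX a b) Q t N M.
Proof. intros H1 <- H2 H3; exact (conj H1 (conj H2 H3)). Qed.

Lemma wp_ReadD a b c i j (Q : assertion) t N M : (a < U /\ b < U /\ c < U)%nat ->
  N b = i -> N c = j -> (i < n /\ j < n)%nat ->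
  Q (S t) N (updR M a (dpow alpha (x i) (x j))) -> wp (ReadD a b c) Q t N M.
Proof. intros H1 <- <- H2 H3; exact (conj H1 (conj H2 H3)). Qed.

End Rules.

Ltac sim := repeat match goal with
  | |- context [updN ?f ?a ?v ?b] =>
      first [rewrite (updN_eq f a v b) by lia | rewrite (updN_ne f a v b) by lia]
  | |- context [updR ?f ?a ?v ?b] =>
      first [rewrite (updR_eq f a v b) by lia | rewrite (updR_ne f a v b) by lia]
  | H : ?f ?a = _ |- context [?f ?a] => is_var f; rewrite H
  end.
Ltac side := try solve [cbn [nopf] in *; sim; lia].
Ltac val := cbn [nopf]; sim; reflexivity.

Ltac go1 := lazymatch goal with
  | |- wp _ _ _ _ _ _ (Seq _ _) _ _ _ _ => apply wp_Seq; go1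
  | |- wp _ _ _ _ _ _ Skip _ _ _ _ => apply wp_Skip
  | |- wp _ _ _ _ _ _ (IfN _ _ _ _) _ _ _ _ => apply wp_IfN; [lia| |]; sim; intros ?Hc
  | |- wp _ _ _ _ _ _ (IfR _ _ _ _) _ _ _ _ => apply wp_IfR; [lia| |]; sim; intros ?Hc
  | |- wp _ _ _ _ _ _ (Ins ?i) _ _ _ _ => lazymatch i with
    | NConst _ _ => apply wp_NConst; [side|side|]
    | ReadN _ => apply wp_ReadN; [side|side|]
    | ReadP _ => apply wp_ReadP; [side|side|]
    | NArith _ _ _ _ => eapply wp_NArith; [side|val|side|]
    | NLoad _ _ => eapply wp_NLoad; [side|val|side|val|]
    | NStore _ _ => eapply wp_NStore; [side|val|side|val|]
    | RZero _ => apply wp_RZero; [side|]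
    | RArith _ _ _ _ => eapply wp_RArith; [side|]; cbn [ropf]
    | RLoad _ _ => eapply wp_RLoad; [side|val|side|]
    | RStore _ _ => eapply wp_RStore; [side|val|side|]
    | ReadX _ _ => eapply wp_ReadX; [side|val|side|]
    | ReadD _ _ _ => eapply wp_ReadD; [side|val|val|side|]
    end
  end.
Ltac go := repeat go1.

(** * Sorting with a tournament tree *)

Section Sorting.
Context (U W : nat) (alpha : R) (n p : nat) (x : nat -> point).
Context (HU : (4 * n + 32 <= U)%nat) (HW : (8 * n + 64 <= W)%nat).
Context (Hn : (2 <= n)%nat) (Hpn : (p <= n)%nat) (Hx : pareto n x).
Notation wp := (wp U W alpha n p x).
Notation X i := (fst (x i)).

(* Cells [0 .. 15] are registers, among them the constants below.  Node [u] of the tree is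
   at [n + 16 + u], the [j]-th point in sorted order at [3 * n + 16 + j], and the current
   row of the dynamic programming in the real cells [16 + i].  The greedy selection later
   reuses the tree area, from [n + 16] on; this area lies above the output cells. *)
Definition regs (N : nat -> nat) : Prop :=
  N 0%nat = (n + 16)%nat /\ N 1%nat = n /\ N 2%nat = 1%nat /\ N 3%nat = 2%nat /\
  N 4%nat = 0%nat /\ N 5%nat = (3 * n + 16)%nat /\ N 14%nat = 16%nat /\ N 15%nat = p.

(* Entries of the tournament tree are [S i] for the point [x i], and [0] for no point. *)
Definition best (a b : nat) : nat :=
  match b, a with
  | O, _ => a
  | _, O => b
  | S j, S i => if Rlt_dec (X j) (X i) then b else a
  end.

(** Register [4] holds [0], so adding it is a move. The same idiom, with a zero cell for words or
    reals, recurs in the later programs. *)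
Definition best_cmd : cmd :=
  IfN 4 11
    (IfN 4 10
      (NArith NSub 12 10 2;; ReadX 1 12;; NArith NSub 12 11 2;; ReadX 2 12;;
       IfR 2 1 (NArith NAdd 10 11 4) Skip)
      (NArith NAdd 10 11 4))
    Skip.

Lemma best_cmd_spec (Q : assertion) t N M : regs N -> (N 10 <= n)%nat -> (N 11 <= n)%nat ->
  (forall t' N' M', (t' <= t + 10)%nat -> N' 10%nat = best (N 10%nat) (N 11%nat) ->
     (forall c, c <> 10%nat -> c <> 12%nat -> N' c = N c) -> Q t' N' M') ->
  wp best_cmd Q t N M.
Proof.
  intros (H0 & H1 & H2 & H3 & H4 & H5 & H14 & H15) Ha Hb HQ.
  remember (N 10%nat) as a eqn:Ea; remember (N 11%nat) as b eqn:Eb.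
  symmetry in Ea, Eb; unfold best_cmd; go; apply HQ; try lia;
    intros; sim; try reflexivity; destruct a as [|a], b as [|b]; cbn [best]; try lia.
  all: replace (S a - 1)%nat with a in * by lia; replace (S b - 1)%nat with b in * by lia.
  all: destruct Rlt_dec; try lia; lra.
Qed.

Lemma best_le a b : (a <= n)%nat -> (b <= n)%nat -> (best a b <= n)%nat.
Proof.
  intros Ha Hb; destruct a, b; cbn [best]; auto; destruct Rlt_dec; assumption.
Qed.

(* Heap-ordered tree with nodes [1 .. 2n - 1] and leaves [n .. 2n - 1] labelled by [l];
   the node [q] (none if [q = 0]) may disagree with its children. *)
Definition tree (q : nat) (l N : nat -> nat) : Prop :=
  (forall u, (1 <= u < 2 * n)%nat -> (N (n + 16 + u) <= n)%nat) /\
  (forall u, (1 <= u < n)%nat -> u <> q ->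
     N (n + 16 + u)%nat = best (N (n + 16 + (u + u))%nat) (N (n + 16 + (u + u) + 1)%nat)) /\
  (forall i, (i < n)%nat -> N (n + 16 + (n + i))%nat = l i).

Definition fix_path : cmd :=
  While 2 7
    (NArith NDiv 7 7 3;; NArith NAdd 9 7 7;; NArith NAdd 9 0 9;; NLoad 10 9;;
     NArith NAdd 9 9 2;; NLoad 11 9;; best_cmd;; NArith NAdd 9 0 7;; NStore 9 10).

(** The only possible defect sits at the parent of node [N 7]. Recomputing that parent hands the
    defect to the next ancestor, and the node number is halved each time, hence at most [m]
    rounds. *)
Lemma fix_path_spec l m (Q : assertion) t N M :
  regs N -> (1 <= N 7%nat < 2 * n)%nat -> (N 7%nat < 2 ^ m)%nat -> tree (N 7%nat / 2)%nat l N ->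
  (forall t' N' M', (t' <= t + 20 * m + 2)%nat -> regs N' -> tree 0 l N' ->
     N' 6%nat = N 6%nat -> N' 8%nat = N 8%nat ->
     (forall c, (3 * n + 16 <= c)%nat -> N' c = N c) -> Q t' N' M') ->
  wp fix_path Q t N M.
Proof.
  intros Hregs H7 Hm Htree HQ.
  apply wp_while with (k := m) (I := fun k t' N' M' =>
    (t' + 20 * k <= t + 20 * m)%nat /\ regs N' /\ (1 <= N' 7%nat < 2 * n)%nat /\
    (N' 7%nat < 2 ^ k)%nat /\ tree (N' 7%nat / 2)%nat l N' /\ N' 6%nat = N 6%nat /\ N' 8%nat = N 8%nat /\
    (forall c, (3 * n + 16 <= c)%nat -> N' c = N c)).
  - lia.
  - repeat (split; auto).
  - clear Hregs H7 Hm Htree HQ.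
    intros k t' N' M' (Ht & Hregs & H7 & Hk & Htree & H6 & H8 & Hfr) Hlt.
    pose proof Hregs as (H0 & H1 & H2 & H3 & H4 & H5 & H14 & H15).
    destruct k as [|k]; [cbn in Hk; lia|]; exists k; split; [reflexivity|].
    destruct Htree as (Hle & Hbest & Hleaf).
    assert (Hv : exists v, N' 7%nat = v) by eauto; destruct Hv as [v Hv].
    rewrite Hv, H2 in *; pose proof (Nat.div_mod_eq v 2) as Hdiv.
    pose proof (Nat.mod_upper_bound v 2) as Hmod; remember (v / 2)%nat as h eqn:Eh.
    assert (Hh : (1 <= h < n)%nat) by lia.
    pose proof (Hle (h + h)%nat ltac:(lia)) as Ha.
    pose proof (Hle (h + h + 1)%nat ltac:(lia)) as Hb; rewrite Nat.add_assoc in Hb.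
    do 6 (go1; rewrite <- ?Eh); apply wp_Seq, best_cmd_spec.
    + repeat (split; [sim; reflexivity|]); sim; reflexivity.
    + sim; exact Ha.
    + sim; exact Hb.
    + intros t1 N1 M1 Ht1; sim; intros H10 HN1.
      assert (H10' : (N1 10%nat <= n)%nat) by (rewrite H10; apply best_le; assumption).
      assert (Hr : forall c, (c < 9)%nat -> c <> 7%nat -> N1 c = N' c)
        by (intros; rewrite HN1 by lia; sim; reflexivity).
      assert (Hr0 : N1 0%nat = (n + 16)%nat) by (rewrite Hr; lia).
      assert (Hr7 : N1 7%nat = h) by (rewrite HN1 by lia; sim; reflexivity).
      assert (Hout : forall c, (13 <= c)%nat -> N1 c = N' c)
        by (intros; rewrite HN1 by lia; sim; reflexivity).
      clear HN1; remember (N1 10%nat) as w eqn:Ew; symmetry in Ew; go.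
      assert (Hnew : forall c, (13 <= c)%nat -> c <> (n + 16 + h)%nat ->
        updN (updN N1 9%nat (n + 16 + h)) (n + 16 + h) w c = N' c)
        by (intros; sim; apply Hout; lia).
      assert (Hnewh : updN (updN N1 9%nat (n + 16 + h)) (n + 16 + h) w (n + 16 + h)%nat
        = w) by (sim; reflexivity).
      split; [lia|]; split; [|split; [|split; [|split; [|split; [|split]]]]].
      * repeat split; sim; first [lia|rewrite Hr by lia; lia|rewrite Hout by lia; lia].
      * sim; lia.
      * sim; cbn [Nat.pow] in Hk; lia.
      * split; [|split].
        -- intros u Hu; destruct (Nat.eq_dec u h) as [->|Hne];
             [rewrite Hnewh; exact H10'|rewrite Hnew by lia; apply Hle; lia].
        -- intros u Hu; replace (updN _ _ _ 7%nat) with h by (sim; reflexivity); intros Hne.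
           destruct (Nat.eq_dec u h) as [->|Huh].
           ++ rewrite Hnewh, !Hnew by lia; exact H10.
           ++ assert ((u + u)%nat <> h).
              { intros <-; apply Hne; replace (u + u)%nat with (u * 2)%nat by lia.
                symmetry; apply Nat.div_mul; lia. }
              assert ((u + u + 1)%nat <> h).
              { intros <-; apply Hne; replace (u + u + 1)%nat with (1 + u * 2)%nat by lia.
                rewrite Nat.div_add by lia; reflexivity. }
              rewrite !Hnew by lia; apply Hbest; lia.
        -- intros i Hi; rewrite Hnew by lia; apply Hleaf; lia.
      * sim; rewrite Hr by lia; exact H6.
      * sim; rewrite Hr by lia; exact H8.
      * intros c Hc; rewrite Hnew by lia; apply Hfr; lia.
  - intros k t' N' M' (Ht & Hregs' & H7' & Hk & Htree' & H6 & H8 & Hfr) Hge.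
    apply HQ; auto; [lia|].
    (* At the root [1 / 2] is [0], which numbers no node: no exception is left. *)
    destruct Hregs' as (_ & _ & H2 & _); replace (N' 7%nat) with 1%nat in Htree' by lia.
    exact Htree'.
Qed.

(** The empty entry [0] comes after every point, so exhausted leaves lose all matches. *)
Definition before (a b : nat) : Prop :=
  match b, a with
  | O, _ => True
  | S _, O => False
  | S j, S i => X i <= X j
  end.

Lemma before_refl a : before a a.
Proof. destruct a; cbn; [exact I|lra]. Qed.

Lemma before_trans a b c : before a b -> before b c -> before a c.
Proof. destruct a, b, c; cbn; try easy; lra. Qed.

Lemma best_before a b : before (best a b) a /\ before (best a b) b.
Proof.
  destruct a, b; cbn; try destruct Rlt_dec; cbn; split; auto; lra.
Qed.

Lemma best_choice a b : best a b = a \/ best a b = b.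
Proof. destruct a, b; cbn; auto; destruct Rlt_dec; auto. Qed.

(** Domination goes down from parent [u / 2] to [u]. The origin of the winner is traced through
    children, whose numbers are larger. No power of two is required: each [u < n] has both children
    below [2 n]. *)
Lemma tree_root l N : tree 0 l N ->
  (forall i, (i < n)%nat -> before (N (n + 16 + 1)%nat) (l i)) /\
  exists i, (i < n)%nat /\ N (n + 16 + 1)%nat = l i.
Proof.
  intros (_ & Hbest & Hleaf); split.
  - assert (Hdom : forall u, (1 <= u < 2 * n)%nat ->
      before (N (n + 16 + 1)%nat) (N (n + 16 + u)%nat)).
    { induction u as [u IH] using (well_founded_induction lt_wf); intros Hu.
      destruct (Nat.eq_dec u 1) as [->|Hne]; [apply before_refl|].
      pose proof (Nat.div_mod_eq u 2) as Hdiv; pose proof (Nat.mod_upper_bound u 2) as Hmod.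
      apply before_trans with (N (n + 16 + u / 2)%nat); [apply IH; lia|].
      rewrite Hbest by lia; destruct (best_before
        (N (n + 16 + (u / 2 + u / 2))%nat) (N (n + 16 + (u / 2 + u / 2) + 1)%nat)) as [Hl Hr].
      assert (Hu2 : u = (u / 2 + u / 2)%nat \/ u = (u / 2 + u / 2 + 1)%nat) by lia.
      destruct Hu2 as [E|E].
      - replace (n + 16 + u)%nat with (n + 16 + (u / 2 + u / 2))%nat by lia; exact Hl.
      - replace (n + 16 + u)%nat with (n + 16 + (u / 2 + u / 2) + 1)%nat by lia; exact Hr. }
    intros i Hi; rewrite <- Hleaf by exact Hi; apply Hdom; lia.
  - assert (Hval : forall d u, (2 * n - u <= d)%nat -> (1 <= u < 2 * n)%nat ->
      exists i, (i < n)%nat /\ N (n + 16 + u)%nat = l i).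
    { induction d as [|d IH]; intros u Hd Hu; [lia|].
      destruct (Nat.lt_ge_cases u n) as [Hlt|Hge].
      - rewrite Hbest by lia; destruct (best_choice (N (n + 16 + (u + u))%nat)
          (N (n + 16 + (u + u) + 1)%nat)) as [-> | ->];
          [|rewrite <- Nat.add_assoc]; apply IH; lia.
      - exists (u - n)%nat; split; [lia|]; rewrite <- Hleaf by lia; f_equal; lia. }
    apply (Hval (2 * n)%nat); lia.
Qed.

(** A changed leaf can only disagree with its parent, which is the starting situation of
    [fix_path]. *)
Lemma tree_set_leaf l l' N N' i w : tree 0 l N -> (i < n)%nat -> (w <= n)%nat ->
  N' (n + 16 + (n + i))%nat = w ->
  (forall c, (n + 16 < c < 3 * n + 16)%nat -> c <> (n + 16 + (n + i))%nat -> N' c = N c) ->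
  (forall j, (j < n)%nat -> l' j = if Nat.eqb j i then w else l j) ->
  tree ((n + i) / 2) l' N'.
Proof.
  intros (Hle & Hbest & Hleaf) Hi Hw Hset Hfr Hl'; split; [|split].
  - intros u Hu; destruct (Nat.eq_dec u (n + i)) as [->|Hne]; [lia|].
    rewrite Hfr by lia; apply Hle; lia.
  - intros u Hu Hne.
    assert ((u + u)%nat <> (n + i)%nat).
    { intros E; apply Hne; rewrite <- E; replace (u + u)%nat with (u * 2)%nat by lia.
      symmetry; apply Nat.div_mul; lia. }
    assert ((u + u + 1)%nat <> (n + i)%nat).
    { intros E; apply Hne; rewrite <- E.
      replace (u + u + 1)%nat with (1 + u * 2)%nat by lia.
      rewrite Nat.div_add by lia; reflexivity. }
    rewrite !Hfr by lia; apply Hbest; lia.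
  - intros j Hj; rewrite Hl' by exact Hj; destruct (Nat.eqb_spec j i) as [->|Hne]; [exact Hset|].
    rewrite Hfr by lia; apply Hleaf; exact Hj.
Qed.

(** Memory starts at zero and [0] encodes the absence of a point, so the empty tree is there without
    being built. *)
Lemma tree_init N : (forall c, (n + 16 < c < 3 * n + 16)%nat -> N c = 0%nat) ->
  tree 0 (fun _ => 0%nat) N.
Proof.
  intros H0; split; [|split]; intros u Hu; intros; rewrite !H0 by lia; cbn; lia.
Qed.

Definition height : nat := Nat.log2 n + 2.

Lemma height_spec : (2 * n < 2 ^ height)%nat.
Proof.
  unfold height; destruct (Nat.log2_spec n) as [_ H]; [lia|].
  rewrite Nat.pow_add_r; cbn [Nat.pow] in *; lia.
Qed.

(** The counter is incremented before the store because the entry of point [i] is [S i]. *)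
Definition insert_cmd : cmd :=
  While 6 1
    (NArith NAdd 7 1 6;; NArith NAdd 9 0 7;; NArith NAdd 6 6 2;; NStore 9 6;; fix_path).

Lemma insert_cmd_spec (Q : assertion) t N M :
  regs N -> N 6%nat = 0%nat -> tree 0 (fun _ => 0%nat) N ->
  (forall t' N' M', (t' <= t + n * (20 * height + 10) + 2)%nat -> regs N' ->
     tree 0 S N' -> N' 8%nat = N 8%nat -> Q t' N' M') ->
  wp insert_cmd Q t N M.
Proof.
  intros Hregs H6 Htree HQ.
  apply wp_while with (k := n) (I := fun k t' N' M' =>
    (t' + k * (20 * height + 10) <= t + n * (20 * height + 10))%nat /\ regs N' /\
    (N' 6%nat + k = n)%nat /\ N' 8%nat = N 8%nat /\
    tree 0 (fun j => if Nat.ltb j (N' 6%nat) then S j else 0%nat) N').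
  - lia.
  - rewrite H6; repeat (split; auto).
  - clear Hregs H6 Htree HQ; intros k t' N' M' (Ht & Hregs & H6 & H8 & Htree) Hlt.
    pose proof Hregs as (H0 & H1 & H2 & H3 & H4 & H5 & H14 & H15).
    remember (N' 6%nat) as i eqn:Ei; symmetry in Ei; rewrite H1 in Hlt.
    destruct k as [|k]; [lia|]; exists k; split; [reflexivity|].
    do 4 go1; apply fix_path_spec with (l := fun j => if Nat.ltb j (S i) then S j else 0%nat)
      (m := height).
    + repeat split; sim; lia.
    + sim; lia.
    + sim; pose proof height_spec; lia.
    + sim; apply (tree_set_leaf _ _ _ _ _ (S i) Htree Hlt); [lia|sim; lia| |].
      * intros c Hc Hne; sim; reflexivity.
      * intros j Hj; destruct (Nat.eqb_spec j i) as [->|Hne].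
        -- rewrite (proj2 (Nat.ltb_lt i (S i))) by lia; reflexivity.
        -- destruct (Nat.ltb_spec j (S i)), (Nat.ltb_spec j i); lia.
    + intros t1 N1 M1 Ht1 Hregs1 Htree1; sim; rewrite Nat.add_1_r; intros H6' H8' _.
      rewrite H6'; split; [lia|]; split; [assumption|]; split; [lia|];
      split; [congruence|assumption].
  - intros k t' N' M' (Ht & Hregs' & H6' & H8' & Htree') Hge.
    apply HQ; [lia|assumption| |exact H8'].
    assert (E : N' 6%nat = n) by (destruct Hregs' as (_ & H1 & _); lia); rewrite E in Htree'.
    destruct Htree' as (Ha & Hb & Hc); split; [exact Ha|split; [exact Hb|]].
    intros i Hi; rewrite Hc by exact Hi; rewrite (proj2 (Nat.ltb_lt i n) Hi); reflexivity.
Qed.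

(* [l] holds the points that are still in the tree, [A 0, .., A (k - 1)] those extracted. *)
Definition extracted (k : nat) (l A : nat -> nat) : Prop :=
  (forall j, (j < k)%nat -> (A j < n)%nat) /\
  (forall i j, (i < j)%nat -> (j < k)%nat -> X (A i) < X (A j)) /\
  (forall i, (i < n)%nat ->
     (l i = S i /\ forall j, (j < k)%nat -> X (A j) < X i) \/
     (l i = 0%nat /\ exists j, (j < k)%nat /\ A j = i)).

Lemma extracted_ext k l A A' : (forall j, (j < k)%nat -> A' j = A j) ->
  extracted k l A -> extracted k l A'.
Proof.
  intros HA (H1 & H2 & H3); split; [|split].
  - intros j Hj; rewrite HA by exact Hj; auto.
  - intros i j Hij Hj; rewrite !HA by lia; auto.
  - intros i Hi; destruct (H3 i Hi) as [[Hl H]|(Hl & j & Hj & Hji)].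
    + left; split; [exact Hl|]; intros j Hj; rewrite HA by exact Hj; auto.
    + right; split; [exact Hl|]; exists j; rewrite HA by exact Hj; auto.
Qed.

(** Pigeonhole: otherwise all [n] points would be among the [k] extracted ones. *)
Lemma extracted_remaining k l A : extracted k l A -> (k < n)%nat ->
  exists i, (i < n)%nat /\ l i = S i.
Proof.
  intros (_ & _ & H3) Hk.
  assert (H : forall m, (m <= n)%nat -> (exists i, (i < n)%nat /\ l i = S i) \/
    (forall i, (i < m)%nat -> exists j, (j < k)%nat /\ A j = i)).
  { induction m as [|m IH]; intros Hm; [right; lia|].
    destruct IH as [IH|IH]; [lia|left; exact IH|].
    destruct (H3 m) as [[Hl _]|[_ Hj]]; [lia|left; exists m; auto|right].
    intros i Hi; destruct (Nat.eq_dec i m) as [->|Hne]; [exact Hj|apply IH; lia]. }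
  destruct (H n (le_n n)) as [Hex|Hall]; [exact Hex|exfalso].
  assert (Hlen : (length (seq 0 n) <= length (map A (seq 0 k)))%nat).
  { apply NoDup_incl_length; [apply seq_NoDup|]; intros i Hi; apply in_seq in Hi.
    destruct (Hall i) as (j & Hj & <-); [lia|]; apply in_map, in_seq; lia. }
  rewrite length_map, !length_seq in Hlen; lia.
Qed.

Lemma extracted_surj l A : extracted n l A ->
  forall i, (i < n)%nat -> exists j, (j < n)%nat /\ A j = i.
Proof.
  intros (H1 & H2 & _) i Hi.
  assert (Hincl : incl (seq 0 n) (map A (seq 0 n))).
  { apply NoDup_length_incl.
    - apply NoDup_map_NoDup_ForallPairs; [|apply seq_NoDup].
      intros a b Ha Hb He; apply in_seq in Ha; apply in_seq in Hb.
      apply (sorted_inj n x A H2); [lia|lia|exact He].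
    - rewrite length_map; lia.
    - intros j Hj; apply in_map_iff in Hj as (k & <- & Hk); apply in_seq in Hk.
      specialize (H1 k ltac:(lia)); apply in_seq; lia. }
  assert (Hi' : In i (map A (seq 0 n))) by (apply Hincl, in_seq; lia).
  apply in_map_iff in Hi' as (j & Hj & Hjs); apply in_seq in Hjs; exists j; split; [lia|exact Hj].
Qed.

Lemma extracted_step k l l' A A' r : extracted k l A -> (k < n)%nat ->
  (forall i, (i < n)%nat -> before (S r) (l i)) -> (r < n)%nat -> l r = S r ->
  (forall j, (j < k)%nat -> A' j = A j) -> A' k = r ->
  (forall j, l' j = if Nat.eqb j r then 0%nat else l j) ->
  extracted (S k) l' A'.
Proof.
  intros Hex Hk Hmin Hr Hlr HA HAk Hl'; apply (extracted_ext _ _ _ _ HA) in Hex.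
  destruct Hex as (H1 & H2 & H3); split; [|split].
  - intros j Hj; destruct (Nat.eq_dec j k) as [->|Hne]; [lia|apply H1; lia].
  - intros i j Hij Hj; destruct (Nat.eq_dec j k) as [->|Hne]; [|apply H2; lia].
    rewrite HAk; destruct (H3 r Hr) as [[_ H]|[H _]]; [apply H; lia|congruence].
  - intros i Hi; rewrite Hl'; destruct (Nat.eqb_spec i r) as [->|Hne].
    + right; split; [reflexivity|]; exists k; split; [lia|exact HAk].
    + destruct (H3 i Hi) as [[Hl H]|(Hl & j & Hj & Hji)].
      * left; split; [exact Hl|]; intros j Hj.
        destruct (Nat.eq_dec j k) as [->|Hjk]; [|apply H; lia].
        (* The tree gives a weak inequality only; it is strict because distinct points of a front
           differ in their first coordinate. *)
        specialize (Hmin i Hi); rewrite Hl in Hmin; cbn in Hmin; rewrite HAk.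
        destruct (Rle_lt_or_eq_dec _ _ Hmin) as [|He]; [assumption|].
        apply (pareto_fst_inj n x Hx) in He; congruence.
      * right; split; [exact Hl|]; exists j; split; [lia|exact Hji].
Qed.

Definition extract_cmd : cmd :=
  While 8 1
    (NArith NAdd 9 0 2;; NLoad 10 9;; NArith NSub 10 10 2;; NArith NAdd 9 5 8;;
     NStore 9 10;; NArith NAdd 7 1 10;; NArith NAdd 9 0 7;; NStore 9 4;; fix_path;;
     NArith NAdd 8 8 2).

Notation arr N := (fun j => N (3 * n + 16 + j)%nat).

Lemma extract_cmd_spec (Q : assertion) t N M :
  regs N -> N 8%nat = 0%nat -> tree 0 S N ->
  (forall t' N' M' l, (t' <= t + n * (20 * height + 20) + 2)%nat -> regs N' ->
     extracted n l (arr N') -> Q t' N' M') ->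
  wp extract_cmd Q t N M.
Proof.
  intros Hregs H8 Htree HQ.
  apply wp_while with (k := n) (I := fun k t' N' M' =>
    (t' + k * (20 * height + 20) <= t + n * (20 * height + 20))%nat /\ regs N' /\
    (N' 8%nat + k = n)%nat /\
    exists l, tree 0 l N' /\ extracted (N' 8%nat) l (arr N')).
  - lia.
  - split; [lia|split; [exact Hregs|split; [lia|]]].
    exists S; split; [exact Htree|]; rewrite H8.
    split; [lia|split; [lia|]]; intros i Hi; left; split; [reflexivity|lia].
  - clear Hregs H8 Htree HQ; intros k t' N' M' (Ht & Hregs & H8 & l & Htree & Hex) Hlt.
    pose proof Hregs as (H0 & H1 & H2 & H3 & H4 & H5 & H14 & H15).
    remember (N' 8%nat) as i eqn:Ei; symmetry in Ei; rewrite H1 in Hlt.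
    destruct k as [|k]; [lia|]; exists k; split; [reflexivity|].
    destruct (extracted_remaining _ _ _ Hex Hlt) as (i0 & Hi0 & Hl0).
    destruct (tree_root _ _ Htree) as (Hmin & r & Hr & Hroot).
    (* An empty root would have to come before the remaining entry [S i0], which [before]
       forbids. *)
    assert (Hlr : l r = S r).
    { destruct Hex as (_ & _ & H); destruct (H r Hr) as [[Hl _]|[Hl _]]; [exact Hl|].
      specialize (Hmin i0 Hi0); rewrite Hroot, Hl, Hl0 in Hmin; destruct Hmin. }
    rewrite Hlr in Hroot; rewrite Hroot in Hmin.
    do 3 go1; replace (S r - 1)%nat with r by lia; do 5 go1.
    apply wp_Seq, fix_path_spec
      with (l := fun j => if Nat.eqb j r then 0%nat else l j) (m := height).
    + repeat split; sim; lia.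
    + sim; lia.
    + sim; pose proof height_spec; lia.
    + sim; apply (tree_set_leaf _ _ _ _ _ 0%nat Htree Hr); [lia|sim; lia| |].
      * intros c Hc Hne; sim; reflexivity.
      * reflexivity.
    + intros t1 N1 M1 Ht1 Hregs1 Htree1 _; sim; intros H8' Hfr.
      pose proof Hregs1 as (G0 & G1 & G2 & G3 & G4 & G5 & G14 & G15).
      go; split; [lia|]; split; [repeat split; sim; lia|]; split; [sim; lia|].
      exists (fun j => if Nat.eqb j r then 0%nat else l j); split.
      * destruct Htree1 as (Ha & Hb & Hc); split; [|split].
        -- intros u Hu; sim; auto.
        -- intros u Hu; sim; auto.
        -- intros u Hu; sim; auto.
      * rewrite updN_eq by reflexivity; rewrite Nat.add_1_r.
        apply (extracted_step _ _ _ _ _ r Hex Hlt Hmin Hr Hlr).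
        -- intros j Hj; rewrite updN_ne by lia; rewrite Hfr by lia; sim; reflexivity.
        -- rewrite updN_ne by lia; rewrite Hfr by lia; sim; reflexivity.
        -- reflexivity.
  - intros k t' N' M' (Ht & Hregs' & H8' & l & Htree' & Hex) Hge.
    apply (HQ _ _ _ l); [lia|assumption|].
    destruct Hregs' as (_ & H1 & _); replace (N' 8%nat) with n in Hex by lia; exact Hex.
Qed.

(** * Dynamic programming and greedy reconstruction *)

Section Selection.
Context (alpha_pos : 0 < alpha) (A : nat -> nat).
Context (HAn : forall j, (j < n)%nat -> (A j < n)%nat).
Context (HAlt : forall i j, (i < j)%nat -> (j < n)%nat -> X (A i) < X (A j)).
Notation gap := (gap alpha x A).
Notation level := (level alpha x A).
Notation greedy := (greedy alpha x A).

Definition stored (N : nat -> nat) : Prop :=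
  forall j, (j < n)%nat -> N (3 * n + 16 + j)%nat = A j.

Definition gaps_cmd : cmd :=
  While 6 1
    (NArith NAdd 9 5 6;; NLoad 11 9;; ReadD 1 10 11;; NArith NAdd 9 6 14;; RStore 9 1;;
     NArith NAdd 6 6 2).

Lemma gaps_cmd_spec (Q : assertion) t N M :
  regs N -> stored N -> N 6%nat = 0%nat -> N 10%nat = A 0%nat ->
  (forall t' N' M', (t' <= t + 8 * n + 2)%nat -> regs N' -> stored N' ->
     (forall i, (i < n)%nat -> level 1 i (M' (i + 16)%nat)) -> Q t' N' M') ->
  wp gaps_cmd Q t N M.
Proof.
  intros Hregs Hst H6 H10 HQ.
  apply wp_while with (k := n) (I := fun k t' N' M' =>
    (t' + 8 * k <= t + 8 * n)%nat /\ regs N' /\ stored N' /\ (N' 6%nat + k = n)%nat /\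
    N' 10%nat = A 0%nat /\
    forall i, (i < N' 6%nat)%nat -> M' (i + 16)%nat = gap 0 i).
  - lia.
  - rewrite H6; repeat (split; auto); lia.
  - clear Hregs Hst H6 H10 HQ; intros k t' N' M' (Ht & Hregs & Hst & H6 & H10 & HM) Hlt.
    pose proof Hregs as (H0 & H1 & H2 & H3 & H4 & H5 & H14 & H15).
    remember (N' 6%nat) as i eqn:Ei; symmetry in Ei; rewrite H1 in Hlt.
    destruct k as [|k]; [lia|]; exists k; split; [reflexivity|].
    pose proof (Hst i Hlt) as HAi; pose proof (HAn i Hlt); pose proof (HAn 0%nat ltac:(lia)).
    go; split; [lia|]; split; [repeat split; sim; lia|].
    split; [intros j Hj; sim; apply Hst; exact Hj|].
    split; [sim; lia|]; split; [sim; reflexivity|].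
    sim; intros j Hj; destruct (Nat.eq_dec j i) as [->|Hne]; sim; [reflexivity|].
    apply HM; lia.
  - intros k t' N' M' (Ht & Hregs' & Hst' & H6' & _ & HM) Hge.
    apply HQ; [lia|assumption|assumption|].
    intros i Hi; destruct Hregs' as (_ & H1 & _); rewrite HM by lia.
    apply (level_one alpha alpha_pos n x Hx A HAn HAlt); exact Hi.
Qed.

(* Position [N 6 - 1] is being updated and [N 7] searches its crossing point.  Both only move
   left, so a row takes linear time and can overwrite the previous one from its right end. *)
Definition row_cmd : cmd :=
  While 2 6
    (NArith NSub 12 6 2;; NArith NAdd 9 5 12;; NLoad 10 9;;
     NArith NSub 13 7 2;; NArith NAdd 9 5 13;; NLoad 11 9;; ReadD 1 11 10;;
     NArith NAdd 9 13 14;; RLoad 2 9;;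
     IfR 2 1
       (NArith NAdd 9 5 7;; NLoad 11 9;; ReadD 1 11 10;;
        IfR 1 2 (RArith RAdd 1 2 3) Skip;;
        NArith NAdd 9 12 14;; RStore 9 1;; NArith NAdd 6 12 4)
       (NArith NAdd 7 13 4)).

Lemma row_cmd_spec m (Q : assertion) t N M :
  regs N -> stored N -> N 6%nat = n -> N 7%nat = (n - 1)%nat -> M 3%nat = 0 ->
  (forall i, (i < n)%nat -> level (S m) i (M (i + 16)%nat)) ->
  (forall t' N' M', (t' <= t + 60 * n)%nat -> regs N' -> stored N' -> M' 3%nat = 0 ->
     N' 8%nat = N 8%nat ->
     (forall i, (i < n)%nat -> level (S (S m)) i (M' (i + 16)%nat)) -> Q t' N' M') ->
  wp row_cmd Q t N M.
Proof.
  intros Hregs Hst H6 H7 HM3 Hlev HQ.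
  (* Each round lowers [N 6] or [N 7] by one. Their sum starts at [2 n - 1] and, both staying
     positive, ends at [2]. *)
  apply wp_while with (k := (2 * n - 3)%nat) (I := fun k t' N' M' =>
    (t' + 25 * k <= t + 25 * (2 * n))%nat /\ regs N' /\ stored N' /\ M' 3%nat = 0 /\
    N' 8%nat = N 8%nat /\ (N' 6%nat + N' 7%nat = k + 2)%nat /\
    (1 <= N' 7%nat < n)%nat /\ (1 <= N' 6%nat <= n)%nat /\ (N' 7%nat <= N' 6%nat)%nat /\
    ((N' 7%nat < N' 6%nat)%nat ->
       gap (N' 7%nat) (N' 6%nat - 1) <= M' (N' 7%nat + 16)%nat) /\
    (forall i, (i < N' 6%nat)%nat -> level (S m) i (M' (i + 16)%nat)) /\
    (forall i, (N' 6%nat <= i < n)%nat -> level (S (S m)) i (M' (i + 16)%nat))).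
  - lia.
  - rewrite H6, H7; repeat (split; [auto; lia|]); split; [|split; [auto|intros; lia]].
    intros _; rewrite gap_refl; apply (proj1 (Hlev (n - 1)%nat ltac:(lia))).
  - clear Hregs Hst H6 H7 HM3 Hlev HQ.
    intros k t' N' M' (Ht & Hregs & Hst & HM3 & H8 & Hk & H7 & H6 & H76 & Hge & Hold & Hnew) Hlt.
    pose proof Hregs as (H0 & H1 & H2 & H3 & H4 & H5 & H14 & H15).
    remember (N' 6%nat) as i1 eqn:Ei; symmetry in Ei.
    remember (N' 7%nat) as j eqn:Ej; symmetry in Ej; rewrite H2 in Hlt.
    destruct k as [|k]; [lia|]; exists k; split; [reflexivity|].
    assert (Hi : exists i, i1 = S i) by (exists (i1 - 1)%nat; lia); destruct Hi as [i ->].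
    assert (Hj : exists j0, j = S j0) by (exists (j - 1)%nat; lia); destruct Hj as [j0 ->].
    pose proof (Hst i ltac:(lia)) as HAi; pose proof (HAn i ltac:(lia)) as HAin.
    pose proof (Hst j0 ltac:(lia)) as HAj; pose proof (HAn j0 ltac:(lia)) as HAjn.
    pose proof (Hst (S j0) ltac:(lia)) as HASj; pose proof (HAn (S j0) ltac:(lia)) as HASjn.
    cbn [Nat.sub] in Hge; rewrite Nat.sub_0_r in Hge.
    assert (E1 : (S i - 1)%nat = i) by lia; assert (E2 : (S j0 - 1)%nat = j0) by lia.
    go1; rewrite E1; do 3 go1; rewrite E2; do 6 go1;
      change (dpow alpha (x (A j0)) (x (A i))) with (gap j0 i) in *.
    + assert (Hji : (S j0 <= i)%nat).
      { destruct (Nat.eq_dec (S j0) (S i)) as [E|]; [|lia]; injection E as ->.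
        rewrite gap_refl in Hc; destruct (Hold i) as [Hpos _]; [lia|lra]. }
      specialize (Hge ltac:(lia)).
      pose proof (level_step alpha alpha_pos n x Hx A HAn HAlt m i (S j0) (fun k => M' (k + 16)%nat))
        as Hstep; cbn beta in Hstep; rewrite E2 in Hstep.
      assert (Hnewi : level (S (S m)) i (Rmax (gap (S j0) i) (M' (j0 + 16)%nat)))
        by (apply Hstep; [intros; apply Hold; lia|lia|lia|exact Hge|exact Hc]).
      clear Hstep.
      (* Both outcomes of the maximum restore the same invariant, so it is established once for
         either final state. *)
      assert (Hfin : forall t1 N1 M1, (t1 <= t' + 23)%nat -> regs N1 -> stored N1 ->
        M1 3%nat = 0 -> N1 8%nat = N 8%nat -> N1 6%nat = i -> N1 7%nat = S j0 ->
        M1 (i + 16)%nat = Rmax (gap (S j0) i) (M' (j0 + 16)%nat) ->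
        (forall c, (16 <= c)%nat -> c <> (i + 16)%nat -> M1 c = M' c) ->
        (S t1 + 25 * k <= t + 25 * (2 * n))%nat /\ regs N1 /\ stored N1 /\ M1 3%nat = 0 /\
        N1 8%nat = N 8%nat /\ (N1 6%nat + N1 7%nat = k + 2)%nat /\
        (1 <= N1 7%nat < n)%nat /\ (1 <= N1 6%nat <= n)%nat /\ (N1 7%nat <= N1 6%nat)%nat /\
        ((N1 7%nat < N1 6%nat)%nat ->
           gap (N1 7%nat) (N1 6%nat - 1) <= M1 (N1 7%nat + 16)%nat) /\
        (forall i, (i < N1 6%nat)%nat -> level (S m) i (M1 (i + 16)%nat)) /\
        (forall i, (N1 6%nat <= i < n)%nat -> level (S (S m)) i (M1 (i + 16)%nat))).
      { intros t1 N1 M1 Ht1 Hr1 Hs1 HM13 HN8 HN6 HN7 HMi HMc; rewrite HN6, HN7.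
        split; [lia|]; do 4 (split; [assumption|]); do 4 (split; [lia|]); split; [|split].
        (* The search need not restart for the next position: [gap j (i - 1) <= gap j i <= c j]. *)
        - intros Hlt'; rewrite HMc by lia; eapply Rle_trans; [|exact Hge].
          apply (gap_mono alpha alpha_pos n x Hx A HAn HAlt); lia.
        - intros l Hl; rewrite HMc by lia; apply Hold; lia.
        - intros l Hl; destruct (Nat.eq_dec l i) as [->|Hne]; [rewrite HMi; exact Hnewi|].
          rewrite HMc by lia; apply Hnew; lia. }
      change (gap (S j0) i) with (dpow alpha (x (A (S j0))) (x (A i))) in Hfin.
      go; (apply Hfin;
        [lia|repeat split; sim; lia|intros l Hl; sim; apply Hst; exact Hl|
         sim; reflexivity|sim; reflexivity|sim; lia|sim; reflexivity| |
         intros l Hl Hne; sim; reflexivity]); sim.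
      * rewrite Rmax_right by lra; apply Rplus_0_r.
      * rewrite Rmax_left by lra; reflexivity.
    (* Position [0] has level [0], below its positive gap to [i], so the search always stops before
       running off the left end. *)
    + assert (Hj0 : j0 <> 0%nat).
      { intros ->; assert (E0 : M' 16%nat = 0)
          by (apply (level_zero alpha x A m), (Hold 0%nat); lia).
        cbn [Nat.add] in Hc; rewrite E0 in Hc.
        pose proof (gap_pos alpha n x Hx A HAn HAlt 0 i ltac:(lia) ltac:(lia)); lra. }
      go; sim; rewrite Nat.add_0_r.
      split; [lia|]; split; [repeat split; sim; lia|].
      split; [intros l Hl; sim; apply Hst; exact Hl|].
      do 6 (split; [reflexivity || assumption || lia|]); split; [|split].
      * intros _; sim; rewrite E1; exact Hc.
      * intros l Hl; sim; apply Hold; exact Hl.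
      * intros l Hl; sim; apply Hnew; exact Hl.
  - intros k t' N' M' (Ht & Hregs' & Hst' & HM3' & H8 & Hk & H7' & H6' & _ & _ & Hold & Hnew) Hge.
    apply HQ; auto; [lia|].
    assert (E6 : N' 6%nat = 1%nat) by (destruct Hregs' as (_ & _ & H2 & _); lia).
    (* The loop never rewrites position [0], whose level is [0] in the old row and in the new
       one. *)
    rewrite E6 in *; intros i Hi; destruct i as [|i]; [|apply Hnew; lia].
    rewrite (level_zero alpha x A m _ (Hold 0%nat ltac:(lia))).
    apply level_at_zero.
Qed.

Definition rows_cmd : cmd :=
  While 8 15
    (NArith NAdd 6 1 4;; NArith NSub 7 1 2;; row_cmd;; NArith NAdd 8 8 2).

Lemma rows_cmd_spec (Q : assertion) t N M : (2 <= p)%nat ->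
  regs N -> stored N -> N 8%nat = 2%nat -> M 3%nat = 0 ->
  (forall i, (i < n)%nat -> level 1 i (M (i + 16)%nat)) ->
  (forall t' N' M', (t' <= t + p * (60 * n + 5) + 2)%nat -> regs N' -> stored N' ->
     (forall i, (i < n)%nat -> level (p - 1) i (M' (i + 16)%nat)) -> Q t' N' M') ->
  wp rows_cmd Q t N M.
Proof.
  intros Hp Hregs Hst H8 HM3 Hlev HQ.
  apply wp_while with (k := (p - 2)%nat) (I := fun k t' N' M' =>
    (t' + k * (60 * n + 5) <= t + p * (60 * n + 5))%nat /\ regs N' /\ stored N' /\
    M' 3%nat = 0 /\ (N' 8%nat + k = p)%nat /\ (2 <= N' 8%nat)%nat /\
    (forall i, (i < n)%nat -> level (N' 8%nat - 1) i (M' (i + 16)%nat))).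
  - lia.
  - rewrite H8; split; [nia|]; split; [exact Hregs|]; split; [exact Hst|].
    split; [exact HM3|]; split; [lia|]; split; [lia|exact Hlev].
  - clear Hregs Hst H8 HM3 Hlev HQ.
    intros k t' N' M' (Ht & Hregs & Hst & HM3 & H8 & H8' & Hlev) Hlt.
    pose proof Hregs as (H0 & H1 & H2 & H3 & H4 & H5 & H14 & H15).
    remember (N' 8%nat) as q eqn:Eq; symmetry in Eq; rewrite H15 in Hlt.
    destruct k as [|k]; [lia|]; exists k; split; [reflexivity|].
    assert (Hq : exists m, q = S (S m)) by (exists (q - 2)%nat; lia); destruct Hq as [m ->].
    cbn [Nat.sub] in Hlev; rewrite ?Nat.sub_0_r in Hlev.
    do 2 go1; apply wp_Seq, row_cmd_spec with (m := m).
    + repeat split; sim; lia.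
    + intros j Hj; sim; apply Hst; exact Hj.
    + sim; lia.
    + sim; reflexivity.
    + exact HM3.
    + exact Hlev.
    + intros t1 N1 M1 Ht1 Hregs1 Hst1 HM31; sim; intros H81 Hlev1.
      pose proof Hregs1 as (G0 & G1 & G2 & G3 & G4 & G5 & G14 & G15).
      go; split; [lia|]; split; [repeat split; sim; lia|].
      split; [intros j Hj; sim; apply Hst1; exact Hj|].
      split; [exact HM31|]; sim; split; [lia|]; split; [lia|].
      replace (S (S m) + 1 - 1)%nat with (S (S m)) by lia; exact Hlev1.
  - intros k t' N' M' (Ht & Hregs' & Hst' & HM3' & H8' & _ & Hlev') Hge.
    apply HQ; [lia|assumption|assumption|].
    destruct Hregs' as (_ & _ & _ & _ & _ & _ & _ & H15).
    assert (E8 : N' 8%nat = p) by lia; rewrite E8 in Hlev'; exact Hlev'.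
Qed.

Definition greedy_cmd : cmd :=
  While 6 1
    (NArith NAdd 9 5 6;; NLoad 11 9;; ReadD 1 10 11;;
     IfR 1 0 Skip
       (NArith NAdd 9 0 8;; NStore 9 11;; NArith NAdd 8 8 2;; NArith NAdd 10 11 4);;
     NArith NAdd 6 6 2).

Lemma greedy_cmd_spec v (Q : assertion) t N M :
  regs N -> stored N -> N 6%nat = 1%nat -> N 8%nat = 1%nat -> N 10%nat = A 0%nat ->
  N (n + 16)%nat = A 0%nat -> M 0%nat = v ->
  (forall t' N' M' k g, (t' <= t + 15 * n + 2)%nat -> regs N' -> M' 0%nat = v ->
     greedy v n k g -> (forall a, (a < k)%nat -> N' (n + 16 + a)%nat = A (g a)) ->
     Q t' N' M') ->
  wp greedy_cmd Q t N M.
Proof.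
  intros Hregs Hst H6 H8 H10 HS HM HQ.
  apply wp_while with (k := (n - 1)%nat) (I := fun k t' N' M' =>
    (t' + 15 * k <= t + 15 * n)%nat /\ regs N' /\ stored N' /\ M' 0%nat = v /\
    (N' 6%nat + k = n)%nat /\ (1 <= N' 8%nat <= N' 6%nat)%nat /\
    exists g, greedy v (N' 6%nat) (N' 8%nat) g /\ N' 10%nat = A (g (N' 8%nat - 1)%nat) /\
      forall a, (a < N' 8%nat)%nat -> N' (n + 16 + a)%nat = A (g a)).
  - lia.
  - rewrite H6, H8; split; [lia|]; do 3 (split; [assumption|]); do 2 (split; [lia|]).
    exists (fun _ => 0%nat); split; [apply greedy_start|]; split; [exact H10|].
    intros a Ha; replace (n + 16 + a)%nat with (n + 16)%nat by lia; exact HS.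
  - clear Hregs Hst H6 H8 H10 HS HM HQ.
    intros k t' N' M' (Ht & Hregs & Hst & HM & H6 & H8 & g & Hg & H10 & HS) Hlt.
    pose proof Hregs as (H0 & H1 & H2 & H3 & H4 & H5 & H14 & H15).
    remember (N' 6%nat) as i eqn:Ei; symmetry in Ei.
    remember (N' 8%nat) as q eqn:Eq; symmetry in Eq; rewrite H1 in Hlt.
    destruct k as [|k]; [lia|]; exists k; split; [reflexivity|].
    pose proof (Hst i Hlt) as HAi; pose proof (HAn i Hlt).
    assert (Hlast : (g (q - 1)%nat < n)%nat)
      by (destruct Hg as (_ & _ & Hg & _); specialize (Hg (q - 1)%nat); lia).
    pose proof (HAn _ Hlast).
    do 4 go1; change (dpow alpha (x (A (g (q - 1)%nat))) (x (A i)))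
      with (gap (g (q - 1)%nat) i) in *; go.
    + split; [lia|]; split; [repeat split; sim; lia|].
      split; [intros j Hj; sim; apply Hst; exact Hj|]; sim.
      split; [reflexivity|]; split; [lia|]; split; [lia|]; exists g.
      rewrite Nat.add_1_r; split; [|split; [reflexivity|]].
      * apply (greedy_skip alpha alpha_pos n x Hx A HAn HAlt); [lia|exact Hg|lia|exact Hc].
      * intros a Ha; sim; apply HS; exact Ha.
    + split; [lia|]; split; [repeat split; sim; lia|].
      split; [intros j Hj; sim; apply Hst; exact Hj|]; sim.
      split; [reflexivity|]; split; [lia|]; split; [lia|]; exists (updN g q i).
      rewrite !Nat.add_1_r; cbn [Nat.sub]; rewrite Nat.sub_0_r, Nat.add_0_r.
      split; [|split].
      * apply (greedy_take alpha alpha_pos n x Hx A HAn HAlt); [lia|exact Hg|lia|exact Hc].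
      * sim; reflexivity.
      * intros a Ha; destruct (Nat.eq_dec a q) as [->|Hne]; sim; [reflexivity|].
        apply HS; lia.
  - intros k t' N' M' (Ht & Hregs' & _ & HM' & H6' & _ & g & Hg & _ & HS') Hge.
    destruct Hregs' as (H0 & H1 & H'); replace (N' 6%nat) with n in Hg by lia.
    apply (HQ _ _ _ (N' 8%nat) g); [lia|split; auto|assumption|exact Hg|exact HS'].
Qed.

End Selection.

(** * Moving the selection to the output cells *)

Fixpoint upto (f : nat -> cmd) (m : nat) : cmd :=
  match m with
  | O => Skip
  | S m' => Seq (upto f m') (f m')
  end.

Definition copy_cmd : cmd :=
  While 6 15 (NArith NAdd 9 0 6;; NLoad 10 9;; NStore 6 10;; NArith NAdd 6 6 2).

(* The output overwrites the registers, so cells [0 .. 15] are filled last, each one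
   serving as the address register of its own load. *)
Definition output_cmd : cmd :=
  NConst 6 16;; copy_cmd;;
  upto (fun a => Seq (NConst (S a) (S a)) (NArith NAdd (S a) (S a) 0)) 15;;
  upto (fun a => NLoad a a) 16.

Lemma copy_cmd_spec (Q : assertion) t N M :
  regs N -> N 6%nat = 16%nat ->
  (forall t' N', (t' <= t + 6 * p + 2)%nat -> N' 0%nat = (n + 16)%nat ->
     (forall a, (16 <= a)%nat -> (a < p)%nat -> N' a = N (n + 16 + a)%nat) ->
     (forall c, (n + 16 <= c)%nat -> N' c = N c) -> Q t' N' M) ->
  wp copy_cmd Q t N M.
Proof.
  intros Hregs H6 HQ.
  (* Truncated subtraction: for [p <= 16] nothing is copied. Destinations stay below [p <= n], so
     the source area is not overwritten. *)
  apply wp_while with (k := (p - 16)%nat) (I := fun k t' N' M' =>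
    (t' + 6 * k <= t + 6 * p)%nat /\ regs N' /\ (k = p - N' 6%nat)%nat /\
    (16 <= N' 6%nat)%nat /\ M' = M /\
    (forall a, (16 <= a < N' 6%nat)%nat -> N' a = N (n + 16 + a)%nat) /\
    (forall c, (n + 16 <= c)%nat -> N' c = N c)).
  - lia.
  - rewrite H6; split; [lia|]; split; [exact Hregs|]; do 2 (split; [lia|]).
    split; [reflexivity|]; split; [lia|reflexivity].
  - clear Hregs H6 HQ; intros k t' N' M' (Ht & Hregs & Hk & H6 & HM & Hcp & Hfr) Hlt.
    pose proof Hregs as (H0 & H1 & H2 & H3 & H4 & H5 & H14 & H15).
    remember (N' 6%nat) as i eqn:Ei; symmetry in Ei; rewrite H15 in Hlt.
    destruct k as [|k]; [lia|]; exists k; split; [reflexivity|].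
    pose proof (Hfr (n + 16 + i)%nat ltac:(lia)) as HSi.
    go; split; [lia|]; split; [repeat split; sim; lia|]; split; [sim; lia|].
    split; [sim; lia|]; split; [exact HM|]; split.
    + rewrite updN_eq by reflexivity; intros a Ha.
      destruct (Nat.eq_dec a i) as [->|Hne]; sim; [reflexivity|apply Hcp; lia].
    + intros c Hc; sim; apply Hfr; exact Hc.
  - intros k t' N' M' (Ht & Hregs' & Hk & H6' & -> & Hcp & Hfr) Hge.
    destruct Hregs' as (H0 & _ & _ & _ & _ & _ & _ & H15).
    apply HQ; [lia|exact H0| |exact Hfr]; intros a Ha Hap; apply Hcp; lia.
Qed.

Lemma low_addresses_spec m (Q : assertion) t N M :
  (m < 16)%nat -> N 0%nat = (n + 16)%nat ->
  (forall N', (forall c, (1 <= c <= m)%nat -> N' c = (n + 16 + c)%nat) ->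
     (forall c, c = 0%nat \/ (m < c)%nat -> N' c = N c) -> Q (t + 2 * m)%nat N' M) ->
  wp (upto (fun a => Seq (NConst (S a) (S a)) (NArith NAdd (S a) (S a) 0)) m) Q t N M.
Proof.
  intros Hm H0; revert Q; induction m as [|m IH]; intros Q HQ; cbn [upto].
  - apply wp_Skip; rewrite <- (Nat.add_0_r t); apply HQ; [lia|reflexivity].
  - apply wp_Seq, IH; [lia|]; intros N' HN' Hfr.
    assert (H0' : N' 0%nat = (n + 16)%nat) by (rewrite Hfr by lia; exact H0).
    go; replace (S (S (t + 2 * m))) with (t + 2 * S m)%nat by lia; apply HQ.
    + intros c Hc; destruct (Nat.eq_dec c (S m)) as [->|Hne]; sim; [lia|apply HN'; lia].
    + intros c Hc; sim; apply Hfr; lia.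
Qed.

Lemma low_loads_spec m (Q : assertion) t N M :
  (m <= 16)%nat -> (forall c, (c < 16)%nat -> N c = (n + 16 + c)%nat) ->
  (forall N', (forall c, (c < m)%nat -> N' c = N (n + 16 + c)%nat) ->
     (forall c, (m <= c)%nat -> N' c = N c) -> Q (t + m)%nat N' M) ->
  wp (upto (fun a => NLoad a a) m) Q t N M.
Proof.
  intros Hm HN; revert Q; induction m as [|m IH]; intros Q HQ; cbn [upto].
  - apply wp_Skip; rewrite <- (Nat.add_0_r t); apply HQ; [lia|reflexivity].
  - apply wp_Seq, IH; [lia|]; intros N' HN' Hfr.
    assert (Had : N' m = (n + 16 + m)%nat) by (rewrite Hfr, HN by lia; reflexivity).
    assert (Hval : N' (n + 16 + m)%nat = N (n + 16 + m)%nat) by (apply Hfr; lia).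
    go; rewrite <- Nat.add_succ_r; apply HQ.
    + intros c Hc; destruct (Nat.eq_dec c m) as [->|Hne];
        [rewrite updN_eq by lia; reflexivity|rewrite updN_ne by lia; apply HN'; lia].
    + intros c Hc; rewrite updN_ne by lia; apply Hfr; lia.
Qed.

Lemma output_cmd_spec (Q : assertion) t N M : regs N ->
  (forall t' N', (t' <= t + 6 * p + 50)%nat ->
     (forall a, (a < p)%nat -> N' a = N (n + 16 + a)%nat) -> Q t' N' M) ->
  wp output_cmd Q t N M.
Proof.
  intros Hregs HQ; pose proof Hregs as (H0 & H1 & H2 & H3 & H4 & H5 & H14 & H15).
  unfold output_cmd; go1; apply wp_Seq, copy_cmd_spec.
  - repeat split; sim; lia.
  - sim; reflexivity.
  - intros t1 N1 Ht1 H01 Hcp Hfr1; apply wp_Seq, low_addresses_spec; [lia|exact H01|].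
    intros N2 HN2 Hfr2; apply low_loads_spec; [lia| |].
    + intros c Hc; destruct (Nat.eq_dec c 0) as [->|Hne]; [rewrite Hfr2 by lia; lia|].
      apply HN2; lia.
    + intros N3 HN3 Hfr3; apply HQ; [lia|]; intros a Ha.
      destruct (Nat.lt_ge_cases a 16) as [Hlt|Hge].
      * rewrite HN3, Hfr2, Hfr1 by lia; rewrite updN_ne by lia; reflexivity.
      * rewrite Hfr3, Hfr2, Hcp by lia; rewrite updN_ne by lia; reflexivity.
Qed.

(** * The complete program for arbitrary [p] *)

Definition solve_cmd : cmd :=
  ReadN 1;; ReadP 15;; NConst 2 1;; NConst 3 2;; NConst 14 16;;
  NArith NAdd 0 1 14;; NArith NAdd 5 0 1;; NArith NAdd 5 5 1;;
  insert_cmd;; extract_cmd;;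
  NConst 6 0;; NLoad 10 5;; gaps_cmd;;
  NConst 8 2;; RZero 3;; rows_cmd;;
  NArith NAdd 9 1 14;; NArith NSub 9 9 2;; RLoad 0 9;;
  NLoad 10 5;; NStore 0 10;; NConst 6 1;; NConst 8 1;; greedy_cmd;;
  output_cmd.

Lemma solve_cmd_spec (Q : assertion) N M : 0 < alpha -> (2 <= p)%nat ->
  (forall c, N c = 0%nat) ->
  (forall t N' M', (t < 200 * p * n * Nat.log2 n)%nat -> optimal alpha n p x N' (M' 0%nat) ->
     Q t N' M') ->
  wp solve_cmd Q 0%nat N M.
Proof.
  intros Halpha Hp HN HQ.
  pose proof (HN 4%nat) as HN4; pose proof (HN 6%nat) as HN6; pose proof (HN 8%nat) as HN8.
  unfold solve_cmd; do 8 go1; apply wp_Seq, insert_cmd_spec.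
  { repeat split; sim; lia. }
  { sim; reflexivity. }
  { apply tree_init; intros c Hc; sim; apply HN. }
  intros t1 N1 M1 Ht1 Hregs1 Htree1; sim; intros H81; apply wp_Seq, extract_cmd_spec; auto.
  clear N1 Hregs1 Htree1 H81; intros t2 N1 M2 l Ht2 Hregs1 Hex.
  remember (arr N1) as A eqn:EA; pose proof (extracted_surj _ _ Hex) as HAsurj.
  destruct Hex as (HAn & HAlt & _).
  assert (Hst1 : stored A N1) by (intros j Hj; rewrite EA; reflexivity).
  clear EA; pose proof Hregs1 as (H0 & H1 & H2 & H3 & H4 & H5 & H14 & H15).
  pose proof (Hst1 0%nat ltac:(lia)) as HA0; rewrite Nat.add_0_r in HA0.
  do 2 go1; apply wp_Seq, (gaps_cmd_spec Halpha A HAn HAlt).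
  { repeat split; sim; lia. }
  { intros j Hj; sim; apply Hst1; exact Hj. }
  { sim; reflexivity. }
  { sim; reflexivity. }
  clear N1 Hregs1 Hst1 H0 H1 H2 H3 H4 H5 H14 H15 HA0.
  intros t3 N1 M3 Ht3 Hregs1 Hst1 Hlev1.
  pose proof Hregs1 as (H0 & H1 & H2 & H3 & H4 & H5 & H14 & H15).
  do 2 go1; apply wp_Seq, (rows_cmd_spec Halpha A HAn HAlt); [exact Hp| | | | | |].
  { repeat split; sim; lia. }
  { intros j Hj; sim; apply Hst1; exact Hj. }
  { sim; reflexivity. }
  { sim; reflexivity. }
  { intros i Hi; sim; apply Hlev1; exact Hi. }
  clear N1 Hregs1 Hst1 Hlev1 H0 H1 H2 H3 H4 H5 H14 H15.
  intros t4 N1 M4 Ht4 Hregs1 Hst1 Hlev1.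
  pose proof Hregs1 as (H0 & H1 & H2 & H3 & H4 & H5 & H14 & H15).
  pose proof (Hst1 0%nat ltac:(lia)) as HA0; rewrite Nat.add_0_r in HA0.
  specialize (Hlev1 (n - 1)%nat ltac:(lia)).
  replace (n - 1 + 16)%nat with (n + 16 - 1)%nat in Hlev1 by lia.
  do 7 go1; apply wp_Seq, (greedy_cmd_spec Halpha A HAn HAlt (M4 (n + 16 - 1)%nat)).
  { repeat split; sim; lia. }
  { intros j Hj; sim; apply Hst1; exact Hj. }
  { sim; reflexivity. }
  { sim; reflexivity. }
  { sim; reflexivity. }
  { sim; reflexivity. }
  { sim; reflexivity. }
  clear N1 Hregs1 Hst1 H0 H1 H2 H3 H4 H5 H14 H15 HA0.
  intros t5 N1 M5 k g Ht5 Hregs1 HM5 Hg HS.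
  apply output_cmd_spec; [exact Hregs1|]; intros t6 N' Ht6 HN'.
  destruct (greedy_optimal alpha Halpha n x Hx A HAn HAlt p _ _ _ HAsurj Hp Hpn Hlev1 Hg)
    as [Hk Hopt].
  apply HQ; [|rewrite HM5; apply Hopt; intros i Hi; rewrite HN', HS by lia; reflexivity].
  assert (HL : (1 <= Nat.log2 n)%nat) by (apply Nat.log2_le_pow2; cbn; lia).
  unfold height in *; remember (Nat.log2 n) as L eqn:EL.
  (* The two passes over the tree give [40 n L] and most of [140 n]; the rows give [60 p n]. With
     [2 <= p], [2 <= n] and [1 <= L] the five terms are at most [20], [70], [60], [6] and [30] times
     [p n L], below [200] in total. *)
  assert (Htot : (t6 <= 40 * (n * L) + 140 * n + 60 * (p * n) + 11 * p + 120)%nat)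
    by (clear - Ht1 Ht2 Ht3 Ht4 Ht5 Ht6; lia).
  assert (B1 : (2 * (n * L) <= p * n * L)%nat)
    by (rewrite <- Nat.mul_assoc; apply Nat.mul_le_mono_r; exact Hp).
  assert (B2 : (p * n <= p * n * L)%nat) by (rewrite <- (Nat.mul_1_r (p * n)) at 1;
    apply Nat.mul_le_mono_l; exact HL).
  assert (B3 : (2 * n <= p * n)%nat) by (apply Nat.mul_le_mono_r; exact Hp).
  assert (B4 : (p * 2 <= p * n)%nat) by (apply Nat.mul_le_mono_l; exact Hn).
  replace (200 * p * n * L)%nat with (200 * (p * n * L))%nat by ring; lia.
Qed.

End Sorting.

(** * Selections of two or three points *)

Section SmallSelections.
Context (U W : nat) (alpha : R) (n p : nat) (x : nat -> point).
Context (HU : (16 <= U)%nat) (HW : (n + 16 <= W)%nat) (Hn : (2 <= n)%nat).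
Context (Hx : pareto n x) (alpha_pos : 0 < alpha).
Notation wp := (wp U W alpha n p x).
Notation X i := (fst (x i)).
Notation d i j := (dpow alpha (x i) (x j)).

Definition extremes_cmd : cmd :=
  While 6 3
    (ReadX 1 6;; ReadX 2 0;; IfR 1 2 (NArith NAdd 0 6 7) Skip;;
     ReadX 2 1;; IfR 2 1 (NArith NAdd 1 6 7) Skip;; NArith NAdd 6 6 5).

Definition small_regs (N : nat -> nat) : Prop :=
  N 3%nat = n /\ N 4%nat = p /\ N 5%nat = 1%nat /\ N 7%nat = 0%nat /\ N 8%nat = 2%nat.

Lemma extremes_cmd_spec (Q : assertion) t N M :
  small_regs N -> N 0%nat = 0%nat -> N 1%nat = 0%nat -> N 6%nat = 0%nat ->
  (forall t' N' M' a b, (t' <= t + 12 * n + 2)%nat -> small_regs N' ->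
     N' 0%nat = a -> N' 1%nat = b -> (a < n)%nat -> (b < n)%nat ->
     (forall j, (j < n)%nat -> X a <= X j <= X b) ->
     (forall c, (3 <= c)%nat -> M' c = M c) -> Q t' N' M') ->
  wp extremes_cmd Q t N M.
Proof.
  intros Hregs H0 H1 H6 HQ.
  apply wp_while with (k := n) (I := fun k t' N' M' =>
    (t' + 12 * k <= t + 12 * n)%nat /\ small_regs N' /\ (N' 6%nat + k = n)%nat /\
    (N' 0%nat < n)%nat /\ (N' 1%nat < n)%nat /\
    (forall j, (j < N' 6%nat)%nat -> X (N' 0%nat) <= X j <= X (N' 1%nat)) /\
    (forall c, (3 <= c)%nat -> M' c = M c)).
  - lia.
  - rewrite H0, H1, H6; split; [lia|]; split; [exact Hregs|]; do 3 (split; [lia|]).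
    split; [lia|reflexivity].
  - clear Hregs H0 H1 H6 HQ.
    intros k t' N' M' (Ht & Hregs & H6 & H0 & H1 & Hext & HM) Hlt.
    pose proof Hregs as (H3 & H4 & H5 & H7 & H8).
    remember (N' 6%nat) as i eqn:Ei; symmetry in Ei; rewrite H3 in Hlt.
    remember (N' 0%nat) as a eqn:Ea; symmetry in Ea.
    remember (N' 1%nat) as b eqn:Eb; symmetry in Eb.
    destruct k as [|k]; [lia|]; exists k; split; [reflexivity|].
    assert (Hfin : forall t1 N1 M1 a' b', (t1 <= t' + 11)%nat -> small_regs N1 ->
      N1 6%nat = S i -> N1 0%nat = a' -> N1 1%nat = b' -> (a' < n)%nat -> (b' < n)%nat ->
      X a' <= X a -> X a' <= X i -> (X b <= X b' \/ i = 0%nat) -> X i <= X b' ->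
      (forall c, (3 <= c)%nat -> M1 c = M' c) ->
      (S t1 + 12 * k <= t + 12 * n)%nat /\ small_regs N1 /\ (N1 6%nat + k = n)%nat /\
      (N1 0%nat < n)%nat /\ (N1 1%nat < n)%nat /\
      (forall j, (j < N1 6%nat)%nat -> X (N1 0%nat) <= X j <= X (N1 1%nat)) /\
      (forall c, (3 <= c)%nat -> M1 c = M c)).
    { intros t1 N1 M1 a' b' Ht1 Hr1 HN6 HN0 HN1 Ha' Hb' Haa Hai Hbb Hbi HM1.
      rewrite HN6, HN0, HN1; split; [lia|]; split; [exact Hr1|].
      split; [lia|]; split; [exact Ha'|]; split; [exact Hb'|]; split.
      - intros j Hj; destruct (Nat.eq_dec j i) as [->|Hne]; [lra|].
        specialize (Hext j ltac:(lia)); destruct Hbb as [Hbb| ->]; [lra|lia].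
      - intros c Hcc; rewrite HM1 by exact Hcc; apply HM; exact Hcc. }
    go; rewrite ?Nat.add_0_r in *;
      (eapply Hfin; [lia|repeat split; sim; lia|sim; lia|sim; reflexivity|sim; reflexivity| | |
        | | | |intros c Hcc; sim; reflexivity]; try lia; try lra; try (left; lra)).
  - intros k t' N' M' (Ht & Hregs' & H6' & H0' & H1' & Hext & HM) Hge.
    apply (HQ _ _ _ (N' 0%nat) (N' 1%nat)); auto; [lia|].
    intros j Hj; apply Hext; destruct Hregs' as (H3 & _); lia.
Qed.

Definition middle_cmd : cmd :=
  While 6 3
    (ReadD 1 0 6;; ReadD 2 6 1;; IfR 2 1 (RArith RAdd 1 2 4) Skip;;
     IfR 3 1 (RArith RAdd 3 1 4;; NArith NAdd 2 6 7) Skip;; NArith NAdd 6 6 5).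

(** The extreme points are scanned too, but they score [0] and a record starting at [0] is only
    beaten strictly. Hence the recorded index is meaningful just when [0 < v]. *)
Lemma middle_cmd_spec a b (Q : assertion) t N M :
  small_regs N -> N 0%nat = a -> N 1%nat = b -> (a < n)%nat -> (b < n)%nat ->
  N 6%nat = 0%nat -> M 3%nat = 0 -> M 4%nat = 0 ->
  (forall t' N' M' c v, (t' <= t + 12 * n + 2)%nat -> N' 0%nat = a -> N' 1%nat = b ->
     N' 2%nat = c -> M' 3%nat = v -> M' 4%nat = 0 -> 0 <= v ->
     (0 < v -> (c < n)%nat /\ v = Rmin (d a c) (d c b)) ->
     (forall j, (j < n)%nat -> Rmin (d a j) (d j b) <= v) -> Q t' N' M') ->
  wp middle_cmd Q t N M.
Proof.
  intros Hregs H0 H1 Ha Hb H6 HM3 HM4 HQ.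
  apply wp_while with (k := n) (I := fun k t' N' M' =>
    (t' + 12 * k <= t + 12 * n)%nat /\ small_regs N' /\ (N' 6%nat + k = n)%nat /\
    N' 0%nat = a /\ N' 1%nat = b /\ M' 4%nat = 0 /\ 0 <= M' 3%nat /\
    (0 < M' 3%nat -> (N' 2%nat < n)%nat /\
       M' 3%nat = Rmin (d a (N' 2%nat)) (d (N' 2%nat) b)) /\
    (forall j, (j < N' 6%nat)%nat -> Rmin (d a j) (d j b) <= M' 3%nat)).
  - lia.
  - rewrite H6, HM3; split; [lia|]; split; [exact Hregs|]; split; [lia|].
    do 3 (split; [assumption|]); split; [lra|]; split; [intros; lra|intros; lia].
  - clear Hregs H0 H1 H6 HM3 HM4 HQ.
    intros k t' N' M' (Ht & Hregs & H6 & H0 & H1 & HM4 & HM3 & Hv & Hmax) Hlt.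
    pose proof Hregs as (H3 & H4 & H5 & H7 & H8).
    remember (N' 6%nat) as i eqn:Ei; symmetry in Ei; rewrite H3 in Hlt.
    remember (M' 3%nat) as v eqn:Ev; symmetry in Ev.
    destruct k as [|k]; [lia|]; exists k; split; [reflexivity|].
    assert (Hfin : forall t1 N1 M1, (t1 <= t' + 11)%nat -> small_regs N1 ->
      N1 6%nat = S i -> N1 0%nat = a -> N1 1%nat = b -> M1 4%nat = 0 ->
      M1 3%nat = v /\ N1 2%nat = N' 2%nat /\ Rmin (d a i) (d i b) <= v \/
      M1 3%nat = Rmin (d a i) (d i b) /\ N1 2%nat = i /\ v < Rmin (d a i) (d i b) ->
      (S t1 + 12 * k <= t + 12 * n)%nat /\ small_regs N1 /\ (N1 6%nat + k = n)%nat /\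
      N1 0%nat = a /\ N1 1%nat = b /\ M1 4%nat = 0 /\ 0 <= M1 3%nat /\
      (0 < M1 3%nat -> (N1 2%nat < n)%nat /\
         M1 3%nat = Rmin (d a (N1 2%nat)) (d (N1 2%nat) b)) /\
      (forall j, (j < N1 6%nat)%nat -> Rmin (d a j) (d j b) <= M1 3%nat)).
    { intros t1 N1 M1 Ht1 Hr1 HN6 HN0 HN1 HM14 Hor; rewrite HN6.
      split; [lia|]; split; [exact Hr1|]; split; [lia|]; do 3 (split; [assumption|]).
      destruct Hor as [(-> & -> & Hle)|(-> & -> & Hgt)].
      - split; [exact HM3|]; split; [exact Hv|]; intros j Hj.
        destruct (Nat.eq_dec j i) as [->|Hne]; [exact Hle|apply Hmax; lia].
      - split; [lra|]; split; [split; [exact Hlt|reflexivity]|]; intros j Hj.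
        destruct (Nat.eq_dec j i) as [->|Hne]; [lra|]; specialize (Hmax j ltac:(lia)); lra. }
    go; rewrite ?Nat.add_0_r, ?Rplus_0_r in *;
      (apply Hfin; [lia|repeat split; sim; lia|sim; lia|sim; reflexivity|sim; reflexivity|
        sim; reflexivity|sim; rewrite ?Nat.add_0_r, ?Rplus_0_r; unfold Rmin;
        destruct (Rle_dec (d a i) (d i b));
        first [left; repeat split; (reflexivity || lra) | right; repeat split; (reflexivity || lra)]]).
  - intros k t' N' M' (Ht & Hregs' & H6' & H0' & H1' & HM4' & HM3' & Hv & Hmax) Hge.
    apply (HQ _ _ _ (N' 2%nat) (M' 3%nat)); auto; [lia|].
    intros j Hj; apply Hmax; destruct Hregs' as (H3 & _); lia.
Qed.

Definition small_cmd : cmd :=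
  ReadN 3;; ReadP 4;; NConst 5 1;; NConst 8 2;; extremes_cmd;; ReadD 0 0 1;;
  IfN 8 4 (NConst 6 0;; middle_cmd;; RArith RAdd 0 3 4) Skip.

Lemma selection_middle v sel : feasible n 3 sel -> min_pairwise alpha x 3 sel v ->
  exists l m r, (l < n)%nat /\ (m < n)%nat /\ (r < n)%nat /\ X l <= X m <= X r /\
    v <= d l m /\ v <= d m r.
Proof.
  intros [Hlt _] Hv.
  pose proof (fun i j => min_pairwise_all alpha x 3 sel v i j Hv) as H.
  assert (H01 : v <= d (sel 0%nat) (sel 1%nat)) by (apply H; lia).
  assert (H10 : v <= d (sel 1%nat) (sel 0%nat)) by (apply H; lia).
  assert (H02 : v <= d (sel 0%nat) (sel 2%nat)) by (apply H; lia).
  assert (H20 : v <= d (sel 2%nat) (sel 0%nat)) by (apply H; lia).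
  assert (H12 : v <= d (sel 1%nat) (sel 2%nat)) by (apply H; lia).
  assert (H21 : v <= d (sel 2%nat) (sel 1%nat)) by (apply H; lia).
  clear H; pose proof (Hlt 0%nat ltac:(lia)); pose proof (Hlt 1%nat ltac:(lia)).
  pose proof (Hlt 2%nat ltac:(lia)); clear Hlt Hv.
  generalize dependent (sel 0%nat); generalize dependent (sel 1%nat).
  generalize dependent (sel 2%nat); intros e He e1 H12 H21 H1 e0 H01 H10 H02 H20 H0.
  destruct (Rle_dec (X e0) (X e1)), (Rle_dec (X e1) (X e)), (Rle_dec (X e0) (X e)).
  - exists e0, e1, e; repeat split; auto.
  - exists e0, e1, e; repeat split; auto.
  - exists e0, e, e1; repeat split; auto; lra.
  - exists e, e0, e1; repeat split; auto; lra.
  - exists e1, e0, e; repeat split; auto; lra.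
  - exists e1, e, e0; repeat split; auto; lra.
  - exists e, e1, e0; repeat split; auto; lra.
  - exists e, e1, e0; repeat split; auto; lra.
Qed.

Lemma small_cmd_spec (Q : assertion) N M : (2 <= p <= 3)%nat -> (p <= n)%nat ->
  (forall c, N c = 0%nat) -> (forall c, M c = 0) ->
  (forall t N M', (t < 64 * n)%nat -> optimal alpha n p x N (M' 0%nat) -> Q t N M') ->
  wp small_cmd Q 0%nat N M.
Proof.
  intros Hp Hpn HN HM HQ.
  pose proof (HN 0%nat) as HN0; pose proof (HN 1%nat) as HN1;
    pose proof (HN 6%nat) as HN6; pose proof (HN 7%nat) as HN7.
  unfold small_cmd; do 4 go1; apply wp_Seq, extremes_cmd_spec; try (sim; reflexivity).
  { repeat split; sim; lia. }
  intros t1 N1 M1 a b Ht1 Hregs1 H0 H1 Ha Hb Hext HM1.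
  pose proof Hregs1 as (H3 & H4 & H5 & H7 & H8).
  assert (Hd : forall i j, (i < n)%nat -> (j < n)%nat -> d i j <= d a b).
  { intros i j Hi Hj; pose proof (Hext i Hi); pose proof (Hext j Hj).
    destruct (Rle_dec (X i) (X j)).
    - apply (dpow_mono alpha alpha_pos n x Hx); auto; lra.
    - rewrite dpow_sym; apply (dpow_mono alpha alpha_pos n x Hx); auto; lra. }
  assert (Hab : a <> b).
  { intros <-; assert (E : 0%nat = 1%nat); [|lia].
    apply (pareto_fst_inj n x Hx); [lia|lia|].
    pose proof (Hext 0%nat ltac:(lia)); pose proof (Hext 1%nat ltac:(lia)); lra. }
  do 2 go1.
  - go1; apply wp_Seq, (middle_cmd_spec a b); try (sim; first [reflexivity|assumption]).
    { sim; rewrite HM1 by lia; apply HM. }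
    { sim; rewrite HM1 by lia; apply HM. }
    intros t2 N2 M2 c v Ht2 G0 G1 G2 HM3 HM4 Hv0 Hvc Hmax; go; apply HQ; [lia|].
    sim; rewrite Rplus_0_r; assert (E3 : p = 3%nat) by lia; rewrite E3 in *.
    (* Exchange: keeping the middle point of a selection and moving the outer two to the extremes
       does not shorten its distances to them. *)
    assert (Hub : forall sel w, feasible n 3 sel -> min_pairwise alpha x 3 sel w -> w <= v).
    { intros sel w Hf Hw.
      destruct (selection_middle w sel Hf Hw) as (l & m & r & Hl & Hm & Hr & Hlmr & Hlm & Hmr).
      apply Rle_trans with (Rmin (d a m) (d m b)); [|apply Hmax; exact Hm].
      pose proof (Hext l Hl); pose proof (Hext m Hm); pose proof (Hext r Hr).
      apply Rmin_glb; [apply (Rle_trans _ _ _ Hlm)|apply (Rle_trans _ _ _ Hmr)];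
        apply (dpow_mono alpha alpha_pos n x Hx); auto; lra. }
    assert (Hvpos : 0 < v).
    { assert (Hf : feasible n 3 (fun i => i)) by (split; intros; lia || assumption).
      destruct (min_pairwise_exists alpha x 3 (fun i => i)) as [w Hw]; [lia|].
      apply Rlt_le_trans with w; [exact (min_pairwise_pos _ _ _ Hx _ _ _ Hf Hw)|eauto]. }
    destruct (Hvc Hvpos) as [Hcn Hvmin].
    pose proof (Rmin_l (d a c) (d c b)); pose proof (Rmin_r (d a c) (d c b)).
    (* Coinciding with an extreme would make the minimum [0], against [0 < v]. *)
    assert (Hca : c <> a) by (intros ->; rewrite dpow_refl in *; lra).
    assert (Hcb : c <> b) by (intros ->; rewrite !dpow_refl in *; lra).
    apply optimal_intro; [lia| | |exact Hub].
    + split.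
      * intros i Hi; destruct i as [|[|[|i]]]; [| | |lia]; sim; assumption.
      * intros i j Hi Hj; destruct i as [|[|[|i]]], j as [|[|[|j]]]; try lia; sim; congruence.
    + intros i j Hij Hj; destruct i as [|[|[|i]]], j as [|[|[|j]]]; try lia; sim.
      * pose proof (Hd a c Ha Hcn); lra.
      * lra.
      * rewrite dpow_sym; lra.
  - go; apply HQ; [lia|]; sim; assert (E2 : p = 2%nat) by lia; rewrite E2 in *.
    apply optimal_intro; [lia| | |].
    + split.
      * intros i Hi; destruct i as [|[|i]]; [| |lia]; sim; assumption.
      * intros i j Hi Hj; destruct i as [|[|i]], j as [|[|j]]; try lia; sim; congruence.
    + intros i j Hij Hj; destruct i as [|[|i]], j as [|[|j]]; try lia; sim; lra.
    + intros sel w [Hlt _] (_ & i & j & Hij & Hj & ->); apply Hd; apply Hlt; lia.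
Qed.

End SmallSelections.

(** As [n + 1 >= 3], five of the six factors already contribute [243]. *)
Lemma word_bound n : (2 <= n)%nat -> (8 * n + 64 <= (n + 1) ^ 6)%nat.
Proof.
  intros Hn.
  assert (H : (3 ^ 5 * (n + 1) <= (n + 1) ^ 6)%nat).
  { rewrite (Nat.pow_succ_r' (n + 1) 5), Nat.mul_comm.
    apply Nat.mul_le_mono_l, Nat.pow_le_mono_l; lia. }
  change (3 ^ 5)%nat with 243%nat in H; lia.
Qed.

Lemma solve_cmd_solves alpha n p x : 0 < alpha -> (2 <= p)%nat -> (p <= n)%nat ->
  pareto n x ->
  solves_within (compile 0 solve_cmd ++ Halt :: nil) ((n + 1) ^ 6) alpha n p x
    (200 * p * n * Nat.log2 n) (200 * n).
Proof.
  intros Halpha Hp Hpn Hx; apply wp_solves, solve_cmd_spec; auto; try lia.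
  apply word_bound; lia.
Qed.

Lemma solves_within_mono prog W alpha n p x time time' space space' :
  (time <= time')%nat -> (space <= space')%nat ->
  solves_within prog W alpha n p x time space ->
  solves_within prog W alpha n p x time' space'.
Proof.
  intros Ht Hs (t & s & Hr & Hh & Hle & Hu & Ho); exists t, s.
  exact (conj Hr (conj Hh (conj (Nat.le_trans _ _ _ Hle Ht) (conj (Nat.le_trans _ _ _ Hu Hs) Ho)))).
Qed.

Theorem theorem2 (alpha : R) (Halpha : 0 < alpha) :
  (* polynomially solvable for every p *)
  (exists (prog : list instr) (K C : nat),
     forall (n p : nat) (x : nat -> point),
       (2 <= p)%nat -> (p <= n)%nat -> pareto n x ->
       solves_within prog ((n + 1) ^ K) alpha n p x
         (C * (n + 1) ^ K) (C * (n + 1) ^ K)) /\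
  (* p = 2, 3 : O(n) time, O(1) additional memory *)
  (exists (prog : list instr) (K C : nat),
     forall (n p : nat) (x : nat -> point),
       (2 <= p <= 3)%nat -> (p <= n)%nat -> pareto n x ->
       solves_within prog ((n + 1) ^ K) alpha n p x (C * n) C) /\
  (* p > 3 : O(p n log n) time, O(n) memory *)
  (exists (prog : list instr) (K C : nat),
     forall (n p : nat) (x : nat -> point),
       (3 < p)%nat -> (p <= n)%nat -> pareto n x ->
       solves_within prog ((n + 1) ^ K) alpha n p x
         (C * p * n * Nat.log2 n) (C * n)).
Proof.
  split; [|split].
  - exists (compile 0 solve_cmd ++ Halt :: nil), 6%nat, 200%nat.
    intros n p x Hp Hpn Hx.
    apply (solves_within_mono _ _ _ _ _ _ (200 * p * n * Nat.log2 n) _ (200 * n));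
      [| |apply solve_cmd_solves; assumption].
    (* Each of [p], [n] and [log2 n] is at most [n + 1], so exponent [3] suffices; it becomes [6]
       because [K] is shared with the word bound. *)
    + rewrite <- !Nat.mul_assoc; apply Nat.mul_le_mono_l.
      apply Nat.le_trans with ((n + 1) ^ 3)%nat; [|apply Nat.pow_le_mono_r; lia].
      pose proof (Nat.log2_le_lin n ltac:(lia)); cbn [Nat.pow]; rewrite Nat.mul_1_r.
      repeat apply Nat.mul_le_mono; lia.
    + pose proof (word_bound n ltac:(lia)); lia.
  - exists (compile 0 small_cmd ++ Halt :: nil), 6%nat, 64%nat.
    intros n p x Hp Hpn Hx.
    apply (solves_within_mono _ _ _ _ _ _ (64 * n) _ 64); [lia|lia|].
    pose proof (word_bound n ltac:(lia)).
    apply wp_solves, small_cmd_spec; auto; lia.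
  - exists (compile 0 solve_cmd ++ Halt :: nil), 6%nat, 200%nat.
    intros n p x Hp Hpn Hx; apply solve_cmd_solves; auto; lia.
Qed.
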